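(* For every integer $d\geq 3$ there exists $\gamma_d>0$ such that, with $m_d=\lfloor 5d^{\log_2 d+1}\rfloor$, every primitive distance-regular graph $X$ of diameter $d$ on $n$ vertices satisfies either $\mathrm{motion}(X)\geq \gamma_d n$, or $X$ is geometric with smallest eigenvalue at least $-m_d$.
   Context: A connected graph $X$ of diameter $d$ is distance-regular if there are integers $a_i,b_i,c_i$ ($0\le i\le d$) such that for all vertices $v,w$ with $\mathrm{dist}(v,w)=i$, $w$ has exactly $c_i$ neighbours at distance $i-1$, $a_i$ at distance $i$ and $b_i$ at distance $i+1$ from $v$; $X$ is $k$-regular with $k=b_0$. It is primitive if for every $1\le i\le d$ the distance-$i$ graph $X_i$ (same vertex set, $u\sim v$ iff $\mathrm{dist}_X(u,v)=i$) is connected. The motion $\mathrm{motion}(X)$ is the minimum, over non-identity automorphisms $\sigma$ of $X$, of the number of vertices not fixed by $\sigma$. If $\theta_{\min}$ is the smallest adjacency eigenvalue, a Delsarte clique is a clique of size $1-k/\theta_{\min}$; $X$ is geometric if there is a collection of Delsarte cliques such that every edge lies in exactly one clique of the collection. *)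

(* Defs.v *)
From Stdlib Require Import Reals ZArith.
From HB Require Import structures.
From mathcomp Require Import all_boot all_order all_algebra all_fingroup all_field.
Set Implicit Arguments. Unset Strict Implicit. Unset Printing Implicit Defensive.
Import Order.TTheory GRing.Theory Num.Theory.

Definition m_d (d : nat) : nat :=
  Z.to_nat (Int_part (Rmult (INR 5) (Rpower (INR d) (Rplus (Rdiv (ln (INR d)) (ln (INR 2))) (INR 1))))).

Section Graphs.
Variable n : nat.
Implicit Types (e : rel 'I_n).

Definition simple_graph e := symmetric e /\ irreflexive e.

Fixpoint ball e (k : nat) (u : 'I_n) : {set 'I_n} :=
  if k is k'.+1 then
    ball e k' u :|: [set w | [exists v in ball e k' u, e v w]]
  else [set u].

(* graph distance (= n if unreachable, irrelevant for connected graphs) *)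
Definition dist e (u v : 'I_n) : nat :=
  find (fun k => v \in ball e k u) (iota 0 n).

Definition connected e := forall u v : 'I_n, connect e u v.

Definition has_diameter e (d : nat) :=
  (forall u v : 'I_n, dist e u v <= d) /\ (exists u v : 'I_n, dist e u v = d).

Definition distance_regular e (d : nat) :=
  [/\ simple_graph e, connected e, has_diameter e d &
   exists a b c : nat -> nat, forall i, i <= d -> forall v w : 'I_n,
     dist e v w = i ->
     [/\ #|[set x | e w x & dist e v x == i.-1]| = c i,
         #|[set x | e w x & dist e v x == i]| = a i &
         #|[set x | e w x & dist e v x == i.+1]| = b i]].

Definition dist_graph e (i : nat) : rel 'I_n := fun u v => dist e u v == i.

Definition primitive e (d : nat) :=
  forall i, 1 <= i <= d -> connected (dist_graph e i).

Definition is_aut e (s : {perm 'I_n}) := forall u v, e (s u) (s v) = e u v.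

(* motion: min number of moved points over non-identity automorphisms
   (convention: n if the automorphism group is trivial) *)
Definition motion e : nat :=
  \big[minn/n]_(s : {perm 'I_n} | [forall u, forall v, e (s u) (s v) == e u v]
                                     && (s != 1%g))
     #|[set v | s v != v]|.

Definition adj e : 'M[algC]_n := (\matrix_(i, j) (e i j)%:R)%R.

Definition is_min_eig e (theta : algC) :=
  eigenvalue (adj e) theta /\ forall t, eigenvalue (adj e) t -> (theta <= t)%R.

Definition regular e (k : nat) := forall v : 'I_n, #|[set w | e v w]| = k.

Definition clique e (C : {set 'I_n}) :=
  forall u v, u \in C -> v \in C -> u != v -> e u v.

Definition delsarte_clique e (k : nat) (theta : algC) (C : {set 'I_n}) :=
  clique e C /\ (#|C|%:R = 1 - k%:R / theta :> algC)%R.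

Definition geometric e :=
  exists (k : nat) (theta : algC), [/\ regular e k, is_min_eig e theta &
    exists S : {set {set 'I_n}},
      (forall C, C \in S -> delsarte_clique e k theta C) /\
      (forall u v, e u v -> #|[set C in S | (u \in C) && (v \in C)]| = 1)].

End Graphs.

(* Main.v *)
From Stdlib Require Import Reals ZArith Lra Lia.
Require Import Defs.
From HB Require Import structures.
From mathcomp Require Import all_boot all_order all_algebra all_fingroup all_field.
Set Implicit Arguments. Unset Strict Implicit. Unset Printing Implicit Defensive.
Import Order.TTheory GRing.Theory Num.Theory.

(** If no sphere contains almost all vertices, every pair of vertices is distinguished by linearly many vertices: this holds on average, and primitivity compares the numbers for any two distances. An automorphism moving [x] to [y] moves all vertices distinguishing [x] from [y].

Otherwise almost all vertices are at one distance [t] from any given vertex, so [c_t << b_(t-1)] and [b_t << c_(t+1)]. Outward walks from adjacent vertices then force [b_(t-1)] and [c_(t+1)] to be at least [7 k / (4 d^4)]. If [2 d^4 a_1 < 3 k], a small set cannot contain most neighbours of each of its vertices: this is seen by summing a Green-like function of the distance over the set. Each vertex moved by an automorphism has all but [max (a_1, c_2)] of its neighbours moved, so the motion is linear.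

If [2 d^4 a_1 >= 3 k], then [c_2] is negligible compared to [a_1] and, as in Metsch's criterion, the large maximal cliques form a partial linear space with a constant number [m <= d^4] of lines through each vertex. Factoring [A + m] by the incidence matrix gives least eigenvalue [-m], and Delsarte's bound forces all lines to have size [1 + k / m]. Finally [d^4 <= m_d]. *)

(** * The bound [d ^ 4 <= m_d] *)

Section MdBound.
Local Open Scope R_scope.

(* With [L = ln d], this is [ln 5 + L^2 / ln 2 - 3 L >= 0]: the quadratic has minimum [- 9/4 ln 2], and [2^9 <= 5^4]. *)
Lemma Rpow4_le_quasipoly (x : R) : 1 <= x ->
  x ^ 4 <= 5 * Rpower x (ln x / ln 2 + 1).
Proof.
intros Hx.
assert (H2 : 0 < ln 2) by (rewrite <- ln_1; apply ln_increasing; lra).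
assert (H5 : 9 * ln 2 <= 4 * ln 5).
{ replace 9 with (INR 9) by (simpl; lra).
  replace 4 with (INR 4) by (simpl; lra).
  rewrite <- !ln_pow by lra.
  apply Rlt_le, ln_increasing; simpl; lra. }
replace (x ^ 4) with (exp (4 * ln x)).
2:{ replace 4 with (INR 4) by (simpl; lra).
    rewrite <- ln_pow by lra. apply exp_ln. apply pow_lt. lra. }
replace (5 * Rpower x (ln x / ln 2 + 1)) with
  (exp (ln 5 + (ln x / ln 2 + 1) * ln x)).
2:{ rewrite exp_plus exp_ln; [reflexivity|lra]. }
assert (Hs : 4 * ln x <= ln 5 + (ln x / ln 2 + 1) * ln x).
{ assert (Hsq : 0 <= (ln x / ln 2 - 3 / 2) ^ 2 * ln 2).
  { apply Rmult_le_pos; [apply pow2_ge_0|lra]. }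
  replace ((ln x / ln 2 - 3 / 2) ^ 2 * ln 2) with
    (ln x / ln 2 * ln x - 3 * ln x + 9 / 4 * ln 2) in Hsq by (field; lra).
  lra. }
destruct Hs as [Hs|Hs]; [left; apply exp_increasing; exact Hs|right; now rewrite Hs].
Qed.

End MdBound.

Lemma expn4_le_m_d (d : nat) : 0 < d -> d ^ 4 <= m_d d.
Proof.
move=> d0; rewrite /m_d; set r := Rmult _ _.
have Hd : Rle 1 (INR d) by apply: (le_INR 1); apply/ssrnat.leP.
have Hr : Rle (INR (d ^ 4)) r.
  have E2 : INR 2 = IZR 2 by rewrite INR_IZR_INZ.
  have E5 : INR 5 = IZR 5 by rewrite INR_IZR_INZ.
  have := Rpow4_le_quasipoly Hd; rewrite /r E2 E5 /=.
  suff -> : INR (d ^ 4) = pow (INR d) 4 by [].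
  by rewrite !expnS expn0 !mult_INR /=.
(* [Int_part] is the floor, so [r < Int_part r + 1]; between integers this strict bound yields the
   weak one. *)
have Hz : Z.lt (Z.of_nat (d ^ 4)) (Z.add (Int_part r) 1).
  apply: lt_IZR; rewrite plus_IZR -INR_IZR_INZ.
  have [_ H] := base_Int_part r.
  by move: H Hr; set p := IZR (Int_part r); set q := INR _ => H Hr; lra.
by apply/ssrnat.leP/Nat2Z.inj_le; rewrite Z2Nat.id; lia.
Qed.

From mathcomp Require Import zify ring lra.

(** * Distance *)

Section Distance.
Variables (n : nat) (e : rel 'I_n).
Hypotheses (esym : symmetric e) (eirr : irreflexive e) (econ : connected e).
Local Notation dist := (dist e).
Implicit Types (i j k : nat) (u v w x y z : 'I_n).

Lemma ballSP k u w :
  reflect (w \in ball e k u \/ exists2 v, v \in ball e k u & e v w)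
          (w \in ball e k.+1 u).
Proof.
rewrite /= inE; apply: (iffP orP) => -[h|]; try by left.
  by rewrite inE => /existsP[v /andP[h1 h2]]; right; exists v.
by case=> v h1 h2; right; rewrite inE; apply/existsP; exists v; rewrite h1.
Qed.

Lemma ballD j k u v w : v \in ball e j u -> w \in ball e k v ->
  w \in ball e (j + k) u.
Proof.
move=> hv; elim: k w => [|k IH] w; first by rewrite addn0 inE => /eqP->.
case/ballSP=> [/IH h|[x /IH h exw]]; rewrite addnS; apply/ballSP; first by left.
by right; exists x.
Qed.

Lemma ball_edge u v : e u v -> v \in ball e 1 u.
Proof. by move=> h; apply/ballSP; right; exists u; rewrite ?inE. Qed.

Lemma ball_refl u k : u \in ball e k u.
Proof. by elim: k => [|k IH]; [rewrite inE | apply/ballSP; left]. Qed.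

Lemma ball_sym k u v : (v \in ball e k u) = (u \in ball e k v).
Proof.
suff H x y : y \in ball e k x -> x \in ball e k y by apply/idP/idP; apply: H.
elim: k x y => [|k IH] x y; first by rewrite !inE eq_sym.
case/ballSP=> [/IH h|[z /IH h ezy]]; first by apply/ballSP; left.
by rewrite -add1n; apply: ballD h; apply: ball_edge; rewrite esym.
Qed.

Lemma ball_mono j k u v : j <= k -> v \in ball e j u -> v \in ball e k u.
Proof.
by move=> /subnKC <- h; apply: ballD h _; apply: ball_refl.
Qed.

Lemma ball_path u p : path e u p -> last u p \in ball e (size p) u.
Proof.
elim: p u => [|v p IH] u; first by rewrite inE.
case/andP=> euv /IH; exact: (@ballD 1 _ _ v) (ball_edge euv).
Qed.

Lemma ball_pred_n u v : v \in ball e n.-1 u.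
Proof.
have /connectP[p hp ->] := econ u v.
case/shortenP: hp => p' hp' up' _.
apply: ball_mono (ball_path hp').
have := max_card (mem (u :: p')); rewrite (card_uniqP up') card_ord /=; lia.
Qed.

(** The search in [dist] tries the radii below [n] and would return [n] on failure. It succeeds
    because a duplicate-free path has at most [n.-1] edges, and balls grow with the radius. *)
Lemma mem_ball k u v : (v \in ball e k u) = (dist u v <= k).
Proof.
rewrite /Defs.dist; set P := fun _ => _.
have n0 : 0 < n by apply: leq_ltn_trans (ltn_ord u).
have hP : has P (iota 0 n).
  apply/hasP; exists n.-1; last exact: ball_pred_n.
  by rewrite mem_iota add0n; lia.
have hlt : find P (iota 0 n) < n by rewrite -{2}(size_iota 0 n) -has_find.
have hin := nth_find 0 hP; rewrite nth_iota // add0n in hin.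
apply/idP/idP => [h|h]; last exact: ball_mono h hin.
rewrite leqNgt; apply/negP => lt.
have := before_find 0 lt; rewrite nth_iota ?add0n; last exact: ltn_trans hlt.
by rewrite /P h.
Qed.

Lemma dist_eq0 u v : (dist u v == 0) = (u == v).
Proof. by rewrite -leqn0 -mem_ball inE eq_sym. Qed.

Lemma distxx u : dist u u = 0.
Proof. by apply/eqP; rewrite dist_eq0. Qed.

Lemma dist_sym u v : dist u v = dist v u.
Proof.
by apply/eqP; rewrite eqn_leq -mem_ball ball_sym mem_ball leqnn -mem_ball
  ball_sym mem_ball leqnn.
Qed.

Lemma dist_triangle v u w : dist u w <= dist u v + dist v w.
Proof. by rewrite -mem_ball; apply: ballD; rewrite mem_ball. Qed.

Lemma dist_edge u v : e u v -> dist u v = 1.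
Proof.
move=> h; have := ball_edge h; rewrite mem_ball.
case E: (dist u v) => [|[|]] // _; move/eqP: E.
by rewrite dist_eq0 => /eqP E; rewrite E eirr in h.
Qed.

Lemma dist_pred u v i : dist u v = i.+1 -> exists2 z, e u z & dist z v = i.
Proof.
move=> h; have : u \in ball e i.+1 v by rewrite mem_ball dist_sym h.
case/ballSP=> [|[z]]; rewrite mem_ball dist_sym; first by rewrite h ltnn.
move=> hz ezu; exists z; first by rewrite esym.
have := dist_triangle z u v; rewrite h (@dist_edge u z) ?(esym u) //; lia.
Qed.

Lemma dist1E u v : (dist u v == 1) = e u v.
Proof.
apply/eqP/idP => [h|]; last exact: dist_edge.
by case: (dist_pred h) => z euz /eqP; rewrite dist_eq0 => /eqP <-.
Qed.

Lemma dist_lip x y z : e x y -> dist z x <= (dist z y).+1.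
Proof.
move=> h; have := dist_triangle y z x.
by rewrite (@dist_edge y x) ?addn1 // esym.
Qed.

Lemma dist_aut (s : {perm 'I_n}) : is_aut e s ->
  forall u v, dist (s u) (s v) = dist u v.
Proof.
have ball_aut (f : {perm 'I_n}) : is_aut e f ->
    forall k u v, v \in ball e k u -> f v \in ball e k (f u).
  move=> hf k u; elim: k => [|k IH] v; first by rewrite !inE => /eqP->.
  case/ballSP=> [/IH h|[x /IH h exv]]; apply/ballSP; first by left.
  by right; exists (f x) => //; rewrite hf.
move=> hs u v; have hs' : is_aut e (s^-1)%g by move=> x y; rewrite -hs !permKV.
apply/eqP; rewrite eqn_leq -!mem_ball ball_aut ?mem_ball //= -mem_ball.
by rewrite -{1}(permK s v) -{2}(permK s u) ball_aut // mem_ball.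
Qed.

End Distance.

(** * Inequalities in ordered fields *)

Lemma growth_tradeoff_arith (R : realFieldType) (V1 V0 b1 b0 bj ch cj n1 n3 n4 s : R) :
    (0 < ch -> 0 < V1 -> 0 < b0 -> ch * n1 <= b1 * V0 ->
     n3 <= V1 * bj * s -> n4 <= V1 * cj * s -> V1 <= n1 + (V0 + (n3 + n4)) ->
     b0 * V0 = ch * V1 ->
  1 - b1 / b0 - ch / b0 <= (bj + cj) * s)%R.
Proof.
move=> hc hV hb X1 X3 X4 cov edges.
(* [V0] and [V1] stand for consecutive sphere sizes. The covering bound is divided by [V1], with
   [V0 / V1 = ch / b0] from the edge count. *)
have V0E : (V0 = V1 * (ch / b0))%R.
  by apply: (mulfI (lt0r_neq0 hb)); rewrite edges; field; lra.
have n1le : (n1 <= V1 * (b1 / b0))%R.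
  rewrite -(ler_pM2l hc); apply: (le_trans X1).
  by rewrite V0E le_eqVlt; apply/orP; left; apply/eqP; field; lra.
rewrite -(ler_pM2l hV).
move: V0E n1le; move: (ch / b0)%R (b1 / b0)%R => y z V0E n1le.
by move: cov; rewrite V0E => cov; nra.
Qed.

(** The left side of the last hypothesis is at least [99 / (100 H)], its right side at most
    [101 / 100 * bj * (H - 1) * H / (2 k)]. This gives the factor [198 / 101], rounded down to
    [19 / 10]. *)
Lemma gap_arith (R : realFieldType) (H Q bh bh1 ch bj cj k s : R) :
    (2 <= H -> 100 * H <= Q -> 0 < bh -> 0 < bj -> 0 < k -> 0 <= ch -> 0 <= cj ->
     H * bh1 <= (H - 1) * bh -> Q * ch <= bh -> Q * cj <= bj ->
     s <= (H - 1) * H / 2 / k ->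
     1 - bh1 / bh - ch / bh <= (bj + cj) * s ->
  19 * k <= 10 * ((H - 1) * H ^+ 2) * bj)%R.
Proof.
move=> H2 HQ hbh hbj hk hch0 hcj slow hch hcjQ hs ineq.
have H0 : (0 < H)%R by lra.
have Q0 : (0 < Q)%R by lra.
have e1 : (bh1 / bh <= (H - 1) / H)%R.
  by rewrite ler_pdivrMr // mulrAC ler_pdivlMr // mulrC.
have e2 : (ch / bh <= 1 / (100 * H))%R.
  rewrite ler_pdivrMr // mulrAC ler_pdivlMr; last by lra.
  by rewrite mul1r mulrC; apply: le_trans hch; apply: ler_wpM2r.
have e3 : (cj <= bj / 100)%R.
  rewrite ler_pdivlMr //; apply: le_trans hcjQ.
  by rewrite mulrC; apply: ler_wpM2r => //; lra.
have e4 : ((bj + cj) * s <= bj * (101/100) * ((H - 1) * H / 2 / k))%R.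
  apply: ler_pM => //; first by lra.
    have : (0 <= (bj + cj) * s)%R.
      apply: le_trans ineq.
      have -> : (1 - bh1 / bh - ch / bh = (1 - (H - 1) / H - 1 / (100 * H)) +
         ((H - 1) / H - bh1 / bh) + (1 / (100 * H) - ch / bh))%R by lra.
      have -> : (1 - (H - 1) / H - 1 / (100 * H) = 99 / 100 / H)%R by field; lra.
      have : (0 <= 99 / 100 / H)%R by apply: divr_ge0; lra.
      lra.
    by rewrite pmulr_rge0 //; lra.
  by lra.
have e5 : (99 / 100 / H <= bj * (101/100) * ((H - 1) * H / 2 / k))%R.
  apply: le_trans e4; apply: le_trans ineq.
  have -> : (99 / 100 / H = 1 - (H - 1) / H - 1 / (100 * H))%R by field; lra.
  lra.
have HK : (0 < H * k)%R by apply: mulr_gt0.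
move: e5; rewrite -(ler_pM2r HK).
have -> : (99 / 100 / H * (H * k) = 99 / 100 * k)%R by field; lra.
have -> : (bj * (101/100) * ((H - 1) * H / 2 / k) * (H * k) =
           101 / 200 * ((H - 1) * H ^+ 2 * bj))%R by field; lra.
move: ((H - 1) * H ^+ 2 * bj)%R (mulrA (10 : R) ((H - 1) * H ^+ 2) bj)%R => z <-.
lra.
Qed.

(** Each of [up] and [down] costs [1 / (16 N)] and [al] leaves [7 / (4 N)], so [14 - 1 = 13] eighths
    of [1 / N] remain. *)
Lemma flow_arith (R : realFieldType) (N K k w up down al : R) :
    (0 < N -> K = 16 * N -> 0 <= w -> K * up <= k * w -> K * down <= k * w ->
     4 * N * al <= (4 * N - 7) * k ->
  up + al * w + down <= k * (1 - 13 / (8 * N)) * w)%R.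
Proof.
move=> N0 KE w0 hup hdown hal; rewrite KE in hup hdown.
have N16 : (0 < 16 * N)%R by lra.
rewrite -(ler_pM2l N16).
have -> : (16 * N * (k * (1 - 13 / (8 * N)) * w) = (16 * N - 26) * k * w)%R.
  by field; lra.
have : (4 * N * al * w <= (4 * N - 7) * k * w)%R by apply: ler_wpM2r.
lra.
Qed.

Lemma isoperimetry_arith (R : realFieldType) (N M k V Kd Kt : R) :
    (0 < Kd -> 0 < N -> 0 < V -> 0 < k ->
     k / (8 * N) * Kd <= 3 * k * (Kd * Kt) / V * M ->
  V <= 24 * N * Kt * M)%R.
Proof.
move=> Kd0 N0 V0 k0 h.
have F : (0 < V^-1 * (k / (8 * N) * Kd))%R.
  by rewrite mulr_gt0 ?invr_gt0 // mulr_gt0 // divr_gt0 //; lra.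
rewrite -(ler_pM2l F).
have -> : (V^-1 * (k / (8 * N) * Kd) * V = k / (8 * N) * Kd)%R.
  by field; lra.
apply: (le_trans h); rewrite le_eqVlt; apply/predU1P; left.
by field; lra.
Qed.

(** * Intersection numbers *)

Definition sphere n (e : rel 'I_n) (v : 'I_n) (i : nat) : {set 'I_n} :=
  [set x | dist e v x == i].

Section DistanceRegular.
Variables (n d : nat) (e : rel 'I_n) (a b c : nat -> nat).
Hypotheses (esym : symmetric e) (eirr : irreflexive e) (econ : connected e).
Hypothesis dist_le_diam : forall u v, dist e u v <= d.
Hypothesis diam_attained : exists u v, dist e u v = d.
Hypothesis cE : forall v w,
  #|[set x | e w x & dist e v x == (dist e v w).-1]| = c (dist e v w).
Hypothesis aE : forall v w,
  #|[set x | e w x & dist e v x == dist e v w]| = a (dist e v w).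
Hypothesis bE : forall v w,
  #|[set x | e w x & dist e v x == (dist e v w).+1]| = b (dist e v w).

Local Notation dist := (dist e).
Local Notation S := (sphere e).
Local Notation k := (b 0).
Implicit Types (i j h : nat) (u v w x y z : 'I_n).

Let distC := dist_sym esym econ.
Let distlip := dist_lip esym eirr econ.

Lemma dist_neighbor v x y : e x y ->
  [|| dist v y == (dist v x).-1, dist v y == dist v x | dist v y == (dist v x).+1].
Proof.
move=> exy; have h1 := distlip v exy.
have h2 : dist v y <= (dist v x).+1 by apply: distlip; rewrite esym.
lia.
Qed.

(** This is the adjacency operator on functions of the distance. The codomain is general so that it
    serves counting, real estimates and matrices alike. *)
Lemma neighbor_sum (V : nmodType) (F : nat -> V) v w :
  (\sum_(x | e w x) F (dist v x) =
   F (dist v w).-1 *+ c (dist v w) + F (dist v w) *+ a (dist v w)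
   + F (dist v w).+1 *+ b (dist v w))%R.
Proof.
set i := dist v w.
have part j :
   (\sum_(x | e w x && (dist v x == j)) F (dist v x) =
    F j *+ #|[set x | e w x & dist v x == j]|)%R.
  rewrite -sumr_const; apply: eq_big => [x|x /andP[_ /eqP->] //].
  by rewrite inE.
(* At distance 0 the classes [i.-1] and [i] coincide, but both are empty. *)
case: (posnP i) => [i0|ipos].
  have vw : v = w by apply/eqP; rewrite -(dist_eq0 econ) -/i i0.
  have n0 x : e w x -> dist v x = 1 by rewrite vw; apply: dist_edge.
  have -> : c i = 0.
    rewrite -cE -/i i0; apply/eqP; rewrite cards_eq0; apply/eqP/setP => x.
    by rewrite !inE; case h: (e w x) => //=; rewrite n0.
  have -> : a i = 0.
    rewrite -aE -/i i0; apply/eqP; rewrite cards_eq0; apply/eqP/setP => x.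
    by rewrite !inE; case h: (e w x) => //=; rewrite n0.
  rewrite !mulr0n !add0r -bE -/i -part; apply: eq_bigl => x.
  by case h: (e w x) => //=; rewrite n0 // i0.
rewrite (bigID (fun x => dist v x == i.-1)) /= part cE -/i -addrA.
congr (_ + _)%R; rewrite (bigID (fun x => dist v x == i)) /=; congr (_ + _)%R.
  rewrite -aE -/i -part; apply: eq_bigl => x.
  by case: (e w x) => //=; case: eqP => [->|]; rewrite ?andbT ?andbF //; lia.
rewrite -bE -/i -part; apply: eq_bigl => x.
case h: (e w x) => //=; have := dist_neighbor v h; rewrite -/i; lia.
Qed.

Lemma degreeE w : #|[set x | e w x]| = k.
Proof.
rewrite -(distxx econ w) -bE; apply: eq_card => x; rewrite !inE (distxx econ).
by rewrite (dist1E esym eirr econ) andbb.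
Qed.

Lemma exists_dist i : i <= d -> exists v w, dist v w = i.
Proof.
move=> id; rewrite -(subKn id); elim: (d - i) => [|j [v [w h]]].
  by rewrite subn0.
case E: (d - j.+1) => [|l]; first by exists v, v; rewrite (distxx econ).
have hd : dist v w = l.+2 by rewrite h; lia.
by have [z _ hz] := dist_pred esym eirr econ hd; exists z, w.
Qed.

Lemma intersection_sum i : i <= d -> c i + a i + b i = k.
Proof.
case/exists_dist=> v [w <-].
have := @neighbor_sum nat (fun _ => 1%R) v w.
by rewrite -(degreeE w) cardsE sumr_const !natn => ->.
Qed.

Lemma sphere_edges v i : b i * #|S v i| = c i.+1 * #|S v i.+1|.
Proof.
have h1 : \sum_(x in S v i) \sum_(y in S v i.+1) (e x y : nat) = b i * #|S v i|.
  rewrite mulnC -sum_nat_const; apply: eq_bigr => x; rewrite inE => /eqP hx.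
  rewrite -hx -bE -sum1_card big_mkcond [RHS]big_mkcond /=.
  by apply: eq_bigr => y _; rewrite !inE andbC; case: eqP; case: (e x y).
rewrite -h1 exchange_big mulnC -sum_nat_const; apply: eq_bigr => y.
rewrite inE => /eqP hy.
rewrite -hy -cE hy -sum1_card big_mkcond [RHS]big_mkcond /=.
by apply: eq_bigr => x _; rewrite !inE esym andbC; case: eqP; case: (e y x).
Qed.

Lemma c_gt0 i : 0 < i <= d -> 0 < c i.
Proof.
case: i => // i /andP[_ /exists_dist[v [w h]]].
have hw : dist w v = i.+1 by rewrite distC.
have [z ewz hz] := dist_pred esym eirr econ hw.
rewrite -h -cE h; apply/card_gt0P; exists z.
by rewrite inE ewz distC hz /=.
Qed.

Lemma b_gt0 i : i < d -> 0 < b i.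
Proof.
case/exists_dist=> v [w h].
have hw : dist w v = i.+1 by rewrite distC.
have [z ewz hz] := dist_pred esym eirr econ hw.
have hz' : dist v z = i by rewrite distC.
rewrite -hz' -bE hz'; apply/card_gt0P; exists w.
by rewrite inE esym ewz h /=.
Qed.

Lemma b_diam : b d = 0.
Proof.
have [v [w h]] := diam_attained.
rewrite -h -bE; apply/eqP; rewrite cards_eq0; apply/eqP/setP => x.
rewrite !inE h; apply/negbTE/nandP; right.
by have := dist_le_diam v x; lia.
Qed.

(** Let [z] follow [v] on a geodesic to [w]: a neighbour of [w] leading away from [v] also leads
    away from [z]. Dually, one leading towards [z] leads towards [v], whence [c_incrS]. *)
Lemma b_decrS i : i < d -> b i.+1 <= b i.
Proof.
case/exists_dist=> v [w h]; have [z evz hz] := dist_pred esym eirr econ h.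
rewrite -h -hz -!bE; apply: subset_leq_card; apply/subsetP => x.
rewrite !inE h hz => /andP[ewx /eqP hx]; rewrite ewx /=.
have h1 := distlip x evz; have h2 : dist z x <= (dist z w).+1.
  by apply: distlip; rewrite esym.
by move: h1; rewrite (distC x v) (distC x z) hx; lia.
Qed.

Lemma c_incrS i : 0 < i < d -> c i <= c i.+1.
Proof.
case/andP=> i0 /exists_dist[v [w h]]; have [z evz hz] := dist_pred esym eirr econ h.
rewrite -h -hz -!cE; apply: subset_leq_card; apply/subsetP => x.
rewrite !inE h hz => /andP[ewx /eqP hx]; rewrite ewx /=.
have h1 := distlip x evz; have := distlip v ewx.
by move: h1; rewrite (distC x v) (distC x z) hx h; lia.
Qed.

Lemma b_decr i j : i <= j <= d -> b j <= b i.
Proof.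
case/andP=> /subnKC <-; elim: (j - i) => [|l IH] hd; first by rewrite addn0.
by rewrite addnS (leq_trans (b_decrS _)) ?IH //; lia.
Qed.

Lemma c_incr i j : 0 < i -> i <= j <= d -> c i <= c j.
Proof.
move=> i0 /andP[/subnKC <-]; elim: (j - i) => [|l IH] hd; first by rewrite addn0.
by rewrite addnS (leq_trans (IH _)) ?c_incrS //; lia.
Qed.

(** The sphere size, defined without a base vertex. Up to the diameter the quotient is exact by the
    edge count [sphere_edges]. *)
Fixpoint valency i : nat := if i is j.+1 then valency j * b j %/ c j.+1 else 1.

Lemma card_sphere v i : #|S v i| = valency i.
Proof.
elim: i => [|i IH] /=.
  rewrite -(cards1 v); apply: eq_card => x.
  by rewrite !inE (dist_eq0 econ) eq_sym.
rewrite -IH mulnC sphere_edges mulnC.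
case: (leqP i.+1 d) => hi; first by rewrite mulnK // c_gt0 //; lia.
have -> : #|S v i.+1| = 0.
  apply/eqP; rewrite cards_eq0; apply/eqP/setP => x; rewrite !inE.
  by have := dist_le_diam v x; lia.
by rewrite mul0n div0n.
Qed.

Lemma valency_edges i : b i * valency i = c i.+1 * valency i.+1.
Proof.
have [v _] := diam_attained.
by have := sphere_edges v i; rewrite !card_sphere.
Qed.

Lemma valency_gt0 i : i <= d -> 0 < valency i.
Proof.
elim: i => [//|i IH] hi.
have := valency_edges i; have := IH (ltnW hi); have := b_gt0 hi.
by case: (valency i.+1) => // h1 h2; rewrite muln0; nia.
Qed.

Lemma exists_at_dist v i : i <= d -> exists w, dist v w = i.
Proof.
move=> /valency_gt0; rewrite -(card_sphere v) => /card_gt0P[w].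
by rewrite inE => /eqP; exists w.
Qed.

(** * Outward walks and the dominant distance *)

(** Double count the edges from [S v h] to the part of [S v h.+1] outside [G]: a start outside [G]
    has at most [b h] of them, a start in [G] at most [q]. *)
Lemma escape_step (G : {set 'I_n}) q v h :
    (forall x, x \in G -> #|[set y | e x y & y \notin G]| <= q) ->
  c h.+1 * #|S v h.+1 :\: G| <= b h * #|S v h :\: G| + q * #|S v h|.
Proof.
move=> Gq.
have -> : c h.+1 * #|S v h.+1 :\: G| =
          \sum_(y in S v h.+1 :\: G) \sum_(x in S v h) (e x y : nat).
  rewrite mulnC -sum_nat_const; apply: eq_bigr => y.
  rewrite !inE => /andP[_ /eqP hy].
  rewrite -hy -cE hy -sum1_card big_mkcond [RHS]big_mkcond /=.
  by apply: eq_bigr => x _; rewrite !inE esym andbC; case: eqP; case: (e x y).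
rewrite exchange_big /= (bigID (mem (S v h :\: G))) /=; apply: leq_add.
  apply: (@leq_trans (\sum_(x in S v h :\: G) b h)); last first.
    by rewrite sum_nat_const mulnC.
  rewrite big_mkcond [leqRHS]big_mkcond /=; apply: leq_sum => x _.
  rewrite andbC !inE; case: (x \in G) => //=; case: eqP => //= hx.
  rewrite -hx -bE -sum1_card big_mkcond [leqRHS]big_mkcond /=.
  apply: leq_sum => y _; rewrite !inE hx.
  by case: (y \in G); case: eqP; case: (e x y).
apply: (@leq_trans (\sum_(x in S v h) q)); last by rewrite sum_nat_const mulnC.
rewrite [leqRHS](bigID (mem (S v h :\: G))) /=; apply: leq_trans (leq_addl _ _).
apply: leq_sum => x; rewrite !inE => /andP[hx].
rewrite hx andbT negbK => /Gq; apply: leq_trans.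
rewrite -sum1_card big_mkcond [leqRHS]big_mkcond /=.
by apply: leq_sum => y _; rewrite !inE; case: (y \in G); case: eqP; case: (e x y).
Qed.

Local Open Scope ring_scope.
Variable R : realFieldType.

Definition inv_b_sum h : R := \sum_(s < h) ((b s)%:R)^-1.

Lemma b_natr_gt0 i : (i < d)%N -> 0 < (b i)%:R :> R.
Proof. by move=> h; rewrite ltr0n b_gt0. Qed.

Lemma valency_natr_gt0 i : (i <= d)%N -> 0 < (valency i)%:R :> R.
Proof. by move=> h; rewrite ltr0n valency_gt0. Qed.

(* [S v h] is reached from [v] by [h] outward steps, the [s]-th of which leaves [G] for at most a fraction [q / b s] of the steps. *)
Lemma escape_bound (G : {set 'I_n}) q v h :
    (forall x, x \in G -> #|[set y | e x y & y \notin G]| <= q)%N ->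
    v \in G -> (h <= d)%N ->
  #|S v h :\: G|%:R <= (valency h)%:R * q%:R * inv_b_sum h :> R.
Proof.
move=> Gq vG; elim: h => [|h IH] hd.
  rewrite /inv_b_sum big_ord0 mulr0.
  rewrite (_ : _ :\: _ = set0) ?cards0 //; apply/setP => x; rewrite !inE.
  by rewrite (dist_eq0 econ); case: eqP => [<-|]; rewrite ?vG ?andbF.
have := escape_step v h Gq; rewrite card_sphere -(ler_nat R) natrD !natrM.
move/(_ (ltnW hd)): IH.
have := congr1 (fun m => m%:R : R) (valency_edges h); rewrite /= !natrM.
have hb := b_natr_gt0 hd.
have hc : 0 < (c h.+1)%:R :> R by rewrite ltr0n c_gt0 //.
rewrite /inv_b_sum big_ord_recr /= -/(inv_b_sum h).
move: (#|S v h.+1 :\: G|%:R) (#|S v h :\: G|%:R) (inv_b_sum h) => B1 B0 s.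
move: hb hc; move: (b h)%:R (c h.+1)%:R (valency h)%:R (valency h.+1)%:R (q%:R).
move=> B C V0 V1 Q hB hC hV IH step.
rewrite -(ler_pM2l hC); apply: (le_trans step).
have -> : C * (V1 * Q * (s + B^-1)) = B * (V0 * Q * s) + Q * V0.
  rewrite -!mulrA mulrA -hV; field; lra.
by rewrite lerD2r ler_pM2l.
Qed.

(** Only vertices on the boundary sphere have edges leaving the ball; [escape_coball] is the same
    for the complement. *)
Lemma escape_ball w j x : (j <= d)%N -> x \in [set y | dist w y <= j]%N ->
  (#|[set y | e x y & y \notin [set y | dist w y <= j]]| <= b j)%N.
Proof.
move=> jd; rewrite inE leq_eqVlt => /orP[/eqP hx|hx].
  rewrite -hx -bE; apply: subset_leq_card; apply/subsetP => y.
  rewrite !inE hx -ltnNge => /andP[exy hy]; rewrite exy /=.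
  have : (dist w y <= (dist w x).+1)%N by apply: distlip; rewrite esym.
  by lia.
rewrite (_ : [set y | _ & _] = set0) ?cards0 //; apply/setP => y.
rewrite !inE; case exy: (e x y) => //=.
have : (dist w y <= (dist w x).+1)%N by apply: distlip; rewrite esym.
by lia.
Qed.

Lemma escape_coball w j x : (j < d)%N -> x \in [set y | j < dist w y]%N ->
  (#|[set y | e x y & y \notin [set y | j < dist w y]]| <= c j.+1)%N.
Proof.
move=> jd; rewrite inE leq_eqVlt => /orP[/eqP hx|hx].
  rewrite hx -cE; apply: subset_leq_card; apply/subsetP => y.
  rewrite !inE => /andP[exy hy]; rewrite exy /=.
  by have := distlip w exy; lia.
rewrite (_ : [set y | _ & _] = set0) ?cards0 //; apply/setP => y.
rewrite !inE; case exy: (e x y) => //=.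
by have := distlip w exy; lia.
Qed.

(* If [u0 ~ u1] and [w] is at distance [j+1] from [u0] but [j] from [u1], outward walks from [u0] stay at distance [> j] from [w] and those from [u1] stay within distance [j], although they mostly end in the common part of [S u0 h] and [S u1 h]. *)
Lemma growth_tradeoff h j : (h < d)%N -> (j < d)%N ->
  1 - (b h.+1)%:R / (b h)%:R - (c h.+1)%:R / (b h)%:R
    <= ((b j)%:R + (c j.+1)%:R) * inv_b_sum h.+1 :> R.
Proof.
move=> hd jd; have [u0 [w h0]] := exists_dist jd.
have [u1 e01 h1] := dist_pred esym eirr econ h0.
have hu0 : S u0 h \subset [set y | dist u1 y <= h.+1]%N.
  apply/subsetP => x; rewrite !inE => /eqP hx.
  by have := distlip x e01; have := distlip x (etrans (esym u1 u0) e01);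
    rewrite !(distC x) hx.
(* This bounds the vertices of [S u0 h.+1] at distance [h.+2] from [u1]; the first term vanishes
   since all of [S u0 h] is within [h.+1] of [u1]. *)
have X1 := escape_step u0 h (fun x => @escape_ball u1 h.+1 x hd).
rewrite (_ : S u0 h :\: _ = set0) ?cards0 ?muln0 ?add0n in X1; last first.
  by apply/eqP; rewrite setD_eq0.
have w1 : u1 \in [set y | dist w y <= j]%N by rewrite inE distC h1.
have w0 : u0 \in [set y | j < dist w y]%N by rewrite inE distC h0.
have X3 := escape_bound (fun x => @escape_ball w j x (ltnW jd)) w1 hd.
have X4 := escape_bound (fun x => @escape_coball w j x jd) w0 hd.
have X2 := card_sphere u1 h.
move: X1 X3 X4; set A1 := S u0 h.+1 :\: _; set A3 := S u1 h.+1 :\: _.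
set A4 := S u0 h.+1 :\: _ => X1 X3 X4.
(* A vertex at distance [h.+1] from [u0] is at distance [h], [h.+1] or [h.+2] from [u1]. In the
   middle case it is in [A3] or [A4] according to its distance from [w]. *)
have cover : S u0 h.+1 \subset A1 :|: (S u1 h :|: (A3 :|: A4)).
  apply/subsetP => x; rewrite !inE => /eqP hx.
  have := distlip x (etrans (esym u1 u0) e01); have := distlip x e01.
  rewrite !(distC x) hx eqxx; lia.
have card_cover : (valency h.+1 <= #|A1| + (valency h + (#|A3| + #|A4|)))%N.
  rewrite -(card_sphere u0) -X2; apply: (leq_trans (subset_leq_card cover)).
  apply: (leq_trans (leq_card_setU _ _)); rewrite leq_add2l.
  apply: (leq_trans (leq_card_setU _ _)); rewrite leq_add2l.
  exact: leq_card_setU.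
have hc : 0 < (c h.+1)%:R :> R by rewrite ltr0n c_gt0.
have hV := valency_natr_gt0 hd.
have hb := b_natr_gt0 hd.
move: X1 X3 X4 card_cover (congr1 (fun m => m%:R : R) (valency_edges h)).
rewrite card_sphere -(ler_nat R) -[(valency h.+1 <= _)%N](ler_nat R) /=.
rewrite !natrD !natrM.
exact: growth_tradeoff_arith.
Qed.

(** * Consequences of a dominant distance *)

Section Dominant.
Variables (t Q : nat).
Hypotheses (d_ge3 : (3 <= d)%N) (t_le_d : (t <= d)%N) (Q_large : (100 * d <= Q)%N).
Hypothesis dominant : (Q * (n - valency t) <= valency t)%N.

Lemma valency_add i j : (i <= d)%N -> (j <= d)%N -> i != j ->
  (valency i + valency j <= n)%N.
Proof.
move=> id jd ij; have [v _] := diam_attained.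
rewrite -(card_sphere v i) -(card_sphere v j) -[leqRHS](card_ord n).
rewrite -cardsUI (_ : S v i :&: S v j = set0) ?cards0 ?addn0 ?max_card //.
by apply/setP => x; rewrite !inE; case: eqP => // ->; apply/negbTE.
Qed.

Lemma dominant_valency i : (i <= d)%N -> i != t -> (Q * valency i <= valency t)%N.
Proof.
move=> id it; apply: leq_trans dominant; rewrite leq_mul2l.
by have := valency_add id t_le_d it; lia.
Qed.

(** A single vertex cannot dominate its neighbours. Nor can distance 1 dominate: two vertices at
    distance 3 have disjoint neighbourhoods of equal size. *)
Lemma dominant_ge2 : (2 <= t)%N.
Proof.
have [v _] := diam_attained.
have v1 : (0 < valency 1)%N by apply: valency_gt0; lia.
case: (ltngtP t 1) => // t01.
  have t0 : t = 0%N by lia.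
  have := @dominant_valency 1; rewrite t0 /= => /(_ _ isT).
  by move: v1 => /=; nia.
have [w hw] := @exists_at_dist v 3 d_ge3.
have : (valency 1 + valency 1 <= n)%N.
  rewrite -{1}(card_sphere v 1) -(card_sphere w 1) -[leqRHS](card_ord n).
  rewrite -cardsUI (_ : S v 1 :&: S w 1 = set0) ?cards0 ?addn0 ?max_card //.
  apply/setP => x; rewrite !inE; apply/negP => /andP[/eqP h1 /eqP h2].
  by have := dist_triangle econ x v w; rewrite hw h1 (distC x) h2.
by move: dominant v1; rewrite t01; nia.
Qed.

Let t_ge2 := dominant_ge2.

(** Compare sphere sizes in the edge count between distances [t.-1] and [t]; [dominant_b] does so
    between [t] and [t.+1]. *)
Lemma dominant_c : (Q * c t <= b t.-1)%N.
Proof.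
have h := @dominant_valency t.-1; have he := valency_edges t.-1.
rewrite (prednK (ltnW t_ge2)) in he.
have vt := valency_gt0 t_le_d.
by rewrite -(leq_pmul2r vt) -mulnA -he mulnCA leq_mul2l h ?orbT //; lia.
Qed.

Lemma dominant_c_le i j : (0 < i <= t)%N -> (j < t)%N -> (Q * c i <= b j)%N.
Proof.
move=> it jt; apply: (@leq_trans (Q * c t)).
  by rewrite leq_mul2l c_incr ?orbT //; lia.
by apply: (leq_trans dominant_c); apply: b_decr; lia.
Qed.

Lemma dominant_b : (Q * b t <= k)%N.
Proof.
case: (ltngtP t d) t_le_d => // [td _|-> _]; last by rewrite b_diam muln0.
have hv : (Q * valency t.+1 <= valency t)%N by apply: dominant_valency; lia.
apply: (@leq_trans (c t.+1)); last by have := intersection_sum td; lia.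
rewrite -(leq_pmul2r (valency_gt0 t_le_d)) -mulnA valency_edges mulnCA.
by rewrite leq_mul2l hv orbT.
Qed.

(** The hypothesis says that [s.+1 * b s], which starts at [k], does not decrease. *)
Lemma b_slow_lower h : (forall s, s < h -> s.+1 * b s <= s.+2 * b s.+1)%N ->
  (k <= h.+1 * b h)%N.
Proof.
elim: h => [|h IH] slow; first by rewrite mul1n.
by apply: leq_trans (slow h (ltnSn h)); apply: IH => s sh; apply: slow; lia.
Qed.

Lemma inv_b_sum_slow h : (forall s, s < h -> k <= s.+1 * b s)%N -> (h <= d)%N ->
  inv_b_sum h <= (h%:R + 1) * h%:R / 2 / k%:R.
Proof.
have k0 : 0 < k%:R :> R by apply: b_natr_gt0; lia.
elim: h => [|h IH] slow hd; first by rewrite /inv_b_sum big_ord0 !(mulr0, mul0r).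
rewrite /inv_b_sum big_ord_recr /= -/(inv_b_sum h).
have hb := b_natr_gt0 hd.
have h1 : (b h)%:R^-1 <= h.+1%:R / k%:R :> R.
  rewrite ler_pdivlMr // mulrC ler_pdivrMr // -natrM ler_nat.
  exact: slow.
apply: le_trans (lerD (IH (fun s sh => slow s (ltnW sh)) (ltnW hd)) h1) _.
rewrite -natr1 le_eqVlt; apply/predU1P; left; field; lra.
Qed.

(** If [s.+1 * b s] never decreases before [t], then [b j >= k / t]. Otherwise take the first [h]
    where it does. There the left side of [growth_tradeoff] is about [1 / (h + 2)] or more, the slow
    decay before [h] bounds [inv_b_sum h.+1], and [c j.+1] is negligible against [b j]. *)
Lemma b_lower j : (j < t)%N ->
  19 * k%:R <= 10 * ((t%:R - 1) * t%:R ^+ 2) * (b j)%:R :> R.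
Proof.
move=> jt; have k0 : (0 < k)%N by apply: b_gt0; lia.
have bj0 : 0 < (b j)%:R :> R by apply: b_natr_gt0; lia.
have t2 : 2 <= t%:R :> R by rewrite (ler_nat _ 2).
case: (boolP [exists h : 'I_t.-1, (h.+2 * b h.+1 < h.+1 * b h)%N]); last first.
  move=> /existsPn slow; have kb : (k <= j.+1 * b j)%N.
    apply: b_slow_lower => s sj; have st : (s < t.-1)%N by lia.
    by have := slow (Ordinal st); rewrite -leqNgt.
  have {kb} : k%:R <= t%:R * (b j)%:R :> R.
    by rewrite -natrM ler_nat; apply: (leq_trans kb); rewrite leq_mul2r jt orbT.
  move=> kb; have q : 2 <= (t%:R - 1) * t%:R :> R by nra.
  have -> : 10 * ((t%:R - 1) * t%:R ^+ 2) * (b j)%:R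
            = 10 * ((t%:R - 1) * t%:R) * (t%:R * (b j)%:R) :> R by ring.
  by apply: ler_pM => //; lra.
move=> /existsP[h0 fast0].
have exh : exists h, (h < t.-1)%N && (h.+2 * b h.+1 < h.+1 * b h)%N.
  by exists h0; rewrite fast0 andbT.
case: (ex_minnP exh) => h /andP[ht fast] hmin.
have slow s : (s < h)%N -> (s.+1 * b s <= s.+2 * b s.+1)%N.
  move=> sh; rewrite leqNgt; apply/negP => f.
  by have := hmin s; rewrite f andbT; lia.
have hs : inv_b_sum h.+1 <= (h.+2%:R - 1) * h.+2%:R / 2 / k%:R.
  apply: (le_trans (inv_b_sum_slow _ _)); last 2 first.
  - by lia.
  - by rewrite -[h.+2%:R]natr1 addrK [h.+1%:R * _]mulrC.
  by move=> s sh; apply: b_slow_lower => s' ss; apply: slow; lia.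
have hd : (h < d)%N by lia.
have jd : (j < d)%N by lia.
have key : 19 * k%:R <= 10 * ((h.+2%:R - 1) * h.+2%:R ^+ 2) * (b j)%:R :> R.
  apply: (@gap_arith _ _ Q%:R (b h)%:R (b h.+1)%:R (c h.+1)%:R _ (c j.+1)%:R _
            (inv_b_sum h.+1)) => //; rewrite ?ltr0n //.
  - by rewrite (ler_nat _ 2).
  - by rewrite -(natrM _ 100) ler_nat; lia.
  - by apply: b_gt0; lia.
  - by rewrite -[X in _ - X]/(1%:R) -natrB // subn1 -!natrM ler_nat ltnW.
  - by rewrite -natrM ler_nat dominant_c_le //; lia.
  - by rewrite -natrM ler_nat dominant_c_le //; lia.
  exact: growth_tradeoff.
apply: (le_trans key); rewrite ler_pM2r // ler_pM2l //.
have : h.+2%:R <= t%:R :> R by rewrite ler_nat; lia.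
have : 2 <= h.+2%:R :> R by rewrite (ler_nat _ 2).
move: (h.+2)%:R t%:R => x y x2 xy; apply: ler_pM; try lra.
  by apply: sqr_ge0.
by rewrite lerXn2r // nnegrE; lra.
Qed.

(** Take [v] at distance [t.+1] from [u]. Outward walks from [v] tend to stay farther than [t] from
    [u], but the vertices that far are at most a fraction [1 / Q] of [valency t], so nearly all
    walks must escape. *)
Lemma dominant_tail : (t < d)%N ->
  1 - Q%:R^-1 <= (c t.+1)%:R * inv_b_sum t :> R.
Proof.
move=> td; have [u [v huv]] := exists_dist td.
have vG : v \in [set y | t < dist u y]%N by rewrite inE huv.
have esc := escape_bound (fun x => @escape_coball u t x td) vG t_le_d.
have hG : (#|[set y | t < dist u y]| <= n - valency t)%N.
  rewrite -(card_sphere u t) leq_subRL; last first.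
    by rewrite -[leqRHS](card_ord n) max_card.
  rewrite -[leqRHS](card_ord n) -cardsUI.
  rewrite (_ : _ :&: _ = set0) ?cards0 ?addn0 ?max_card //.
  by apply/setP => x; rewrite !inE; case: eqP => //= ->; rewrite ltnn.
have cov : (valency t <= #|S v t :\: [set y | t < dist u y]%N| + (n - valency t))%N.
  rewrite -{1}(card_sphere v t) -(cardsID [set y | t < dist u y]%N (S v t)) addnC.
  by rewrite leq_add2l; apply: leq_trans hG; apply: subset_leq_card; apply: subsetIr.
have Q0 : 0 < Q%:R :> R by rewrite ltr0n; lia.
have V0 := valency_natr_gt0 t_le_d.
move: dominant cov; rewrite -!(ler_nat R) natrD natrM.
move: (n - valency t)%N%:R => W dom cov.
rewrite -(ler_pM2l V0) mulrBr mulr1 mulrA.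
have : W <= (valency t)%:R * Q%:R^-1 by rewrite ler_pdivlMr // mulrC.
lra.
Qed.

Lemma gap_b : (7 * k <= 4 * d ^ 4 * b t.-1)%N.
Proof.
have := @b_lower t.-1; rewrite (prednK (ltnW t_ge2)) leqnn => /(_ isT) h.
have t1 : t%:R - 1 = t.-1%:R :> R by rewrite -subn1 natrB //; lia.
move: h; rewrite t1 -natrX -!natrM ler_nat => h.
have : (t.-1 * t ^ 2 <= d ^ 4)%N.
  apply: (@leq_trans (d ^ 1 * d ^ 2)); last by rewrite -expnD leq_exp2l; lia.
  by rewrite leq_mul ?leq_exp2r //; lia.
move: (t.-1 * t ^ 2)%N h => X; nia.
Qed.

(** Applying [b_lower] to all [t] terms of [inv_b_sum t] costs one more factor [t], so
    [(t - 1) * t ^ 3 <= d ^ 4] is used; [7 / 4] is below [99 / 100 * 19 / 10]. *)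
Lemma gap_c : (t < d)%N -> (7 * k <= 4 * d ^ 4 * c t.+1)%N.
Proof.
move=> td; have tail := dominant_tail td.
have k0 : 0 < k%:R :> R by apply: b_natr_gt0; lia.
pose T : R := 10 * ((t%:R - 1) * t%:R ^+ 2) / (19 * k%:R).
have hT : inv_b_sum t <= t%:R * T.
  rewrite mulr_natl -[X in _ *+ X](card_ord t) -sumr_const.
  apply: ler_sum => s _; have hb : 0 < (b s)%:R :> R.
    by apply: b_natr_gt0; apply: leq_trans (ltn_ord s) _.
  rewrite /T ler_pdivlMr; last by lra.
  by rewrite mulrC ler_pdivrMr // b_lower.
have hQ : Q%:R^-1 <= 1 / 100 :> R.
  rewrite ler_pdivlMr // mulrC ler_pdivrMr ?ltr0n; last by lia.
  by rewrite mul1r (ler_nat _ 100); lia.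
have t2 : 2 <= t%:R :> R by rewrite (ler_nat _ 2).
have h1 : 99 / 100 <= (c t.+1)%:R * (t%:R * T).
  apply: (@le_trans _ _ ((c t.+1)%:R * inv_b_sum t)); first by lra.
  by rewrite ler_wpM2l // ler0n.
have {h1} h1 : 99 / 100 * (19 * k%:R) <= 10 * (c t.+1)%:R * (t%:R * ((t%:R - 1) * t%:R ^+ 2)) :> R.
  have E : 0 < 19 * k%:R :> R by lra.
  move: h1; rewrite -(ler_pM2r E) /T => h1; apply: (le_trans h1).
  by rewrite le_eqVlt; apply/predU1P; left; field; lra.
have h2 : t%:R * ((t%:R - 1) * t%:R ^+ 2) <= (d ^ 4)%N%:R :> R.
  have td' : t%:R <= d%:R :> R by rewrite ler_nat.
  rewrite natrX -[4%N]/(1 + (1 + 2))%N !exprD !expr1.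
  apply: ler_pM; rewrite ?ler0n //; first by apply: mulr_ge0; [lra|apply: sqr_ge0].
  apply: ler_pM; rewrite ?sqr_ge0 //; first by lra.
    by lra.
  by rewrite lerXn2r // nnegrE; lra.
rewrite -(ler_nat R) !natrM.
have : 0 <= (c t.+1)%:R :> R by rewrite ler0n.
by nra.
Qed.

End Dominant.

(** * Distinguishing vertices *)

Definition dist_mx j : 'M[R]_n := \matrix_(u, v) (dist u v == j)%:R.

(** Over a field these matrices form the Bose-Mesner algebra. *)
Definition dist_invariant (K : nmodType) (M : 'M[K]_n) :=
  exists f : nat -> K, forall u v, M u v = f (dist u v).

Lemma mulmx_adj (K : pzRingType) (M : 'M[K]_n) u v :
  (M *m \matrix_(i, j) (e i j)%:R) u v = \sum_(x | e v x) M u x.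
Proof.
rewrite mxE [RHS]big_mkcond /=; apply: eq_bigr => x _; rewrite !mxE esym.
by case: (e v x); rewrite ?mulr1 ?mulr0.
Qed.

Lemma dist_invariant_mul_adj (K : pzRingType) (M : 'M[K]_n) :
  dist_invariant M -> dist_invariant (M *m \matrix_(i, j) (e i j)%:R).
Proof.
case=> f fE; exists (fun i => f i.-1 *+ c i + f i *+ a i + f i.+1 *+ b i).
move=> u v; rewrite mulmx_adj -neighbor_sum.
by apply: eq_bigr => x _; rewrite fE.
Qed.

Lemma dist_invariantD (K : nmodType) (M N : 'M[K]_n) :
  dist_invariant M -> dist_invariant N -> dist_invariant (M + N).
Proof.
by case=> f fE [g gE]; exists (fun i => f i + g i) => u v; rewrite mxE fE gE.
Qed.

Lemma dist_invariantZ (K : pzRingType) (q : K) (M : 'M[K]_n) :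
  dist_invariant M -> dist_invariant (q *: M).
Proof. by case=> f fE; exists (fun i => q * f i) => u v; rewrite mxE fE. Qed.

Lemma dist_mx_adj j : dist_mx j.+1 *m \matrix_(u, v) (e u v)%:R =
  (b j)%:R *: dist_mx j + (a j.+1)%:R *: dist_mx j.+1
    + (c j.+2)%:R *: dist_mx j.+2.
Proof.
apply/matrixP => u v; rewrite mulmx_adj !mxE.
rewrite (eq_bigr (fun x => (dist u x == j.+1)%:R)); last by move=> x _; rewrite mxE.
rewrite (neighbor_sum (fun i => (i == j.+1)%:R)); set i := dist u v.
have -> : (i.-1 == j.+1)%:R *+ c i = (c j.+2)%:R * (i == j.+2)%:R :> R.
  case: i => [|i] /=; first by rewrite mul0rn mulr0.
  by rewrite eqSS; case: eqP => [->|_]; rewrite ?mulr1 // mul0rn mulr0.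
have -> : (i == j.+1)%:R *+ a i = (a j.+1)%:R * (i == j.+1)%:R :> R.
  by case: eqP => [->|_]; rewrite ?mulr1 // mul0rn mulr0.
have -> : (i.+1 == j.+1)%:R *+ b i = (b j)%:R * (i == j)%:R :> R.
  by rewrite eqSS; case: eqP => [->|_]; rewrite ?mulr1 // mul0rn mulr0.
by ring.
Qed.

(** The three-term recurrence [dist_mx_adj] can be solved for its last matrix because [c j.+2] is
    nonzero; hence the induction on two consecutive indices. *)
Lemma dist_invariant_mul_dist (M : 'M[R]_n) j :
  dist_invariant M -> dist_invariant (M *m dist_mx j).
Proof.
move=> hM; suff : dist_invariant (M *m dist_mx j) /\ dist_invariant (M *m dist_mx j.+1).
  by case.
elim: j => [|j [IH0 IH1]]; split=> //.
- rewrite (_ : dist_mx 0 = 1%:M) ?mulmx1 //.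
  by apply/matrixP => u v; rewrite !mxE (dist_eq0 econ).
- rewrite (_ : dist_mx 1 = \matrix_(u, v) (e u v)%:R).
    exact: dist_invariant_mul_adj.
  by apply/matrixP => u v; rewrite !mxE (dist1E esym eirr econ).
case: (leqP j.+2 d) => hj; last first.
  rewrite (_ : dist_mx j.+2 = 0) ?mulmx0.
    by exists (fun _ => 0) => u v; rewrite mxE.
  apply/matrixP => u v; rewrite !mxE; have := dist_le_diam u v.
  by case: eqP => // ->; lia.
have c0 : (c j.+2)%:R != 0 :> R by rewrite pnatr_eq0 -lt0n c_gt0.
have -> : M *m dist_mx j.+2 = (c j.+2)%:R^-1 *:
   ((M *m dist_mx j.+1) *m \matrix_(u, v) (e u v)%:R
    + ((- (b j)%:R) *: (M *m dist_mx j) + (- (a j.+1)%:R) *: (M *m dist_mx j.+1))).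
  rewrite -mulmxA dist_mx_adj !mulmxDr -!scalemxAr !scaleNr -opprD.
  by rewrite [_ + _ *: (M *m dist_mx j.+2)]addrC addrK scalerA mulVf // scale1r.
by apply/dist_invariantZ/dist_invariantD; [apply: dist_invariant_mul_adj|
  apply: dist_invariantD; apply: dist_invariantZ].
Qed.

Definition distinguishing u v : {set 'I_n} := [set z | dist u z != dist v z].

(** The complement is the disjoint union of the sets [S u j :&: S v j], whose sizes are entries of
    the squared distance matrices. *)
Lemma card_distinguishing_inv u v u' v' : dist u v = dist u' v' ->
  #|distinguishing u v| = #|distinguishing u' v'|.
Proof.
have compl x y : (#|~: distinguishing x y| =
                  \sum_(j < d.+1) #|S x j :&: S y j|)%N.
  rewrite -sum1_card (partition_big (fun z => inord (dist x z) : 'I_d.+1) predT) //=.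
  apply: eq_bigr => j _; rewrite -sum1_card; apply: eq_bigl => z.
  rewrite !inE negbK -val_eqE /= inordK ?ltnS //.
  by apply/andP/andP => -[/eqP h1 /eqP h2]; split; apply/eqP; lia.
move=> h; suff hC : #|~: distinguishing u v| = #|~: distinguishing u' v'|.
  by have := cardsC (distinguishing u v); have := cardsC (distinguishing u' v'); lia.
rewrite !compl; apply: eq_bigr => j _.
have inter x y : (dist_mx j *m dist_mx j) x y = #|S x j :&: S y j|%:R.
  rewrite mxE -sum1_card natr_sum [RHS]big_mkcond /=; apply: eq_bigr => z _.
  by rewrite !mxE !inE (distC z y); do 2 case: eqP; rewrite ?mulr1 ?mulr0.
have [|f fE] := @dist_invariant_mul_dist (dist_mx j) j.
  by exists (fun i => (i == j)%:R) => x y; rewrite mxE.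
by apply/eqP; rewrite -(eqr_nat R) -!inter !fE h.
Qed.

Local Open Scope nat_scope.

Lemma distinguishing_triangle v u w :
  #|distinguishing u w| <= #|distinguishing u v| + #|distinguishing v w|.
Proof.
apply: leq_trans (leq_card_setU _ _); apply: subset_leq_card; apply/subsetP => z.
by rewrite !inE; case: (eqVneq (dist u z) (dist v z)) => [->|].
Qed.

(* The set of distances [l] whose pairs are distinguished by at most [s * #|distinguishing x y|] vertices strictly grows with [s] until it is everything, because distance-[i] edges lead out of it. *)
Lemma distinguishing_primitive i x y u v :
    connected (dist_graph e i) -> dist x y = i ->
  #|distinguishing u v| <= d * #|distinguishing x y|.
Proof.
move=> con_i hxy; set m := #|distinguishing x y|.
pose T s := [set l : 'I_d.+1 | [forall u', forall v',
  (dist u' v' == l) ==> (#|distinguishing u' v'| <= s * m)]].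
have TP s u' v' : (inord (dist u' v') \in T s) = (#|distinguishing u' v'| <= s * m).
  rewrite inE; apply/forallP/idP => [/(_ u')/forallP/(_ v')|le u1].
    by rewrite inordK ?ltnS // eqxx.
  apply/forallP => v1; apply/implyP => /eqP h.
  by rewrite (card_distinguishing_inv (u' := u') (v' := v')) // h inordK ?ltnS.
have TS s : T s \subset T s.+1.
  apply/subsetP => l; have [u' [v' h]] := exists_dist (leq_ord l).
  have -> : l = inord (dist u' v') by rewrite h inord_val.
  by rewrite !TP mulSn => h1; apply: leq_trans h1 (leq_addl _ _).
have Tcard s : s <= d -> s < #|T s|.
  elim: s => [|s IH] sd.
    apply/card_gt0P; exists ord0.
    have -> : ord0 = inord (dist x x) :> 'I_d.+1.
      by apply: val_inj; rewrite /= inordK (distxx econ).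
    rewrite TP mul0n leqn0 cards_eq0; apply/eqP/setP => z.
    by rewrite !inE eqxx.
  have {}IH := IH (ltnW sd).
  case: (boolP (T s == setT)) => [/eqP full|].
    apply: leq_trans (subset_leq_card (TS s)).
    by rewrite full cardsT card_ord ltnS.
  rewrite -properT => /properP[_ [l _ lT]].
  have [u' [v' h]] := exists_dist (leq_ord l).
  have {}lT : inord (dist u' v') \notin T s by rewrite h inord_val.
  have [z1 [z2 [hz h1 h2]]] : exists z1 z2, [/\ dist z1 z2 = i,
      inord (dist u' z1) \in T s & inord (dist u' z2) \notin T s].
    have /connectP[p hp lastp] := con_i u' v'.
    have u'T : inord (dist u' u') \in T s.
      rewrite TP (_ : distinguishing _ _ = set0) ?cards0 //.
      by apply/setP => z; rewrite !inE eqxx.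
    rewrite lastp in lT; move: u'T hp lT; move: {2 3 5}u' => q.
    elim: p q {lastp} => [|z p IHp] q /= qT; first by rewrite qT.
    case/andP=> /eqP hqz hp lT.
    case: (boolP (inord (dist u' z) \in T s)) => zT; first exact: IHp zT hp lT.
    by exists q, z.
  have z2T : inord (dist u' z2) \in T s.+1.
    rewrite TP mulSn addnC; apply: leq_trans (distinguishing_triangle z1 _ _) _.
    rewrite TP in h1; apply: leq_add => //.
    by rewrite (card_distinguishing_inv (u' := x) (v' := y)) // hz hxy.
  apply: leq_ltn_trans IH _; apply: proper_card; apply/properP; split => //.
  by exists (inord (dist u' z2)).
have full : T d = setT.
  apply/eqP; rewrite eqEcard subsetT cardsT card_ord; exact: Tcard.
by rewrite -TP full inE.
Qed.

(** Average over pairs: for fixed [z] and [u], more than [n / (Q + 1)] vertices [v] have a distance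
    from [z] other than that of [u]. *)
Lemma exists_well_distinguished Q m :
    (forall i, i <= d -> valency i < Q * (n - valency i)) ->
    (forall u v, #|distinguishing u v| <= m) ->
  n <= Q.+1 * m.
Proof.
move=> nodom hm; have [v0 _] := diam_attained.
have n0 : 0 < n by apply: leq_ltn_trans (ltn_ord v0).
pose D := \sum_(u : 'I_n) \sum_(v : 'I_n) #|distinguishing u v|.
have lower : n * (n * n) <= Q.+1 * D.
  have -> : D = \sum_(z : 'I_n) \sum_(u : 'I_n) #|~: S z (dist z u)|.
    rewrite exchange_big /D /=; apply: eq_bigr => u _.
    under eq_bigr => v _ do rewrite -sum1_card big_mkcond /=.
    under [RHS]eq_bigr => z _ do rewrite -sum1_card big_mkcond /=.
    rewrite exchange_big /=; apply: eq_bigr => z _; apply: eq_bigr => v _.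
    by rewrite !inE (distC u) (distC v) eq_sym.
  rewrite big_distrr /= -[X in X * _](card_ord n) -sum_nat_const.
  apply: leq_sum => z _; rewrite big_distrr /=.
  rewrite -[X in X * _](card_ord n) -sum_nat_const; apply: leq_sum => u _.
  have := nodom _ (dist_le_diam z u); rewrite -(card_sphere z).
  have := cardsC (S z (dist z u)); rewrite card_ord.
  move: #|_| #|_| => p q; nia.
have upper : D <= n * (n * m).
  rewrite -[X in X * _](card_ord n) -sum_nat_const; apply: leq_sum => u _.
  rewrite -[X in X * _](card_ord n) -sum_nat_const; apply: leq_sum => v _.
  exact: hm.
have : n * (n * n) <= n * (n * (Q.+1 * m)).
  by apply: (leq_trans lower); move: upper; nia.
by rewrite !leq_pmul2l.
Qed.

(** A fixed vertex is equally far from [x] and from [s x]. *)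
Lemma card_moved_ge_distinguishing (s : {perm 'I_n}) x : is_aut e s ->
  #|distinguishing x (s x)| <= #|[set v | s v != v]|.
Proof.
move=> hs; apply: subset_leq_card; apply/subsetP => z; rewrite !inE.
apply: contra => /eqP hz; apply/eqP.
by rewrite -{2}hz (dist_aut econ hs).
Qed.

(** * Motion *)

Lemma common_neighbors1 u v : dist u v = 1 -> #|[set z | e u z & e v z]| = a 1.
Proof.
move=> h; rewrite -h -aE h; apply: eq_card => z.
by rewrite !inE (dist1E esym eirr econ) andbC.
Qed.

Lemma common_neighbors2 u v : dist u v = 2 -> #|[set z | e u z & e v z]| = c 2.
Proof.
move=> h; rewrite -h -cE h; apply: eq_card => z.
by rewrite !inE (dist1E esym eirr econ) andbC.
Qed.

Lemma common_neighbors3 u v : 2 < dist u v -> [set z | e u z & e v z] = set0.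
Proof.
move=> h; apply/setP => z; rewrite !inE; apply/negP => /andP[huz hvz].
have := dist_triangle econ z u v; rewrite (distC z).
by rewrite (dist_edge eirr econ huz) (dist_edge eirr econ hvz); lia.
Qed.

Lemma common_neighbors_le u v : u != v ->
  #|[set z | e u z & e v z]| <= maxn (a 1) (c 2).
Proof.
rewrite -(dist_eq0 econ); case h: (dist u v) => [|[|[|m]]] // _.
- by rewrite common_neighbors1 // leq_maxl.
- by rewrite common_neighbors2 // leq_maxr.
by rewrite common_neighbors3 ?cards0 // h.
Qed.

Local Open Scope ring_scope.

(** Let [Phi] sum [g (dist x y)] over [M]. Summing over neighbours of members of [M] gives at least
    [(k - q) * Phi], as each member has [k - q] neighbours inside, and at most
    [rho * Phi + D * #|M|]. Finally [Phi >= g 0]. *)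
Lemma weighted_isoperimetry (g : nat -> R) (rho D : R) t (M : {set 'I_n}) (q : nat) x :
    (forall i, 0 <= g i) -> 0 <= D -> (q <= k)%N ->
    (forall i, (i <= d)%N -> i != t ->
       g i.-1 *+ c i + g i *+ a i + g i.+1 *+ b i <= rho * g i) ->
    g t.-1 *+ c t + g t *+ a t + g t.+1 *+ b t <= rho * g t + D ->
    (forall y, y \in M -> (#|[set z | e y z & z \notin M]| <= q)%N) ->
    x \in M -> 0 <= k%:R - q%:R - rho ->
  (k%:R - q%:R - rho) * g 0%N <= D * #|M|%:R.
Proof.
move=> g0 D0 qk hg hgt hM xM hr.
pose Phi := \sum_(y in M) g (dist x y).
have PhiE : g 0%N <= Phi.
  by rewrite /Phi (bigD1 x) //= (distxx econ) lerDl sumr_ge0.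
have upper : \sum_(y in M) \sum_(z | e y z) g (dist x z) <= rho * Phi + D * #|M|%:R.
  rewrite mulr_natr -sumr_const mulr_sumr -big_split /=; apply: ler_sum => y _.
  rewrite neighbor_sum; case: (eqVneq (dist x y) t) => [->//|ht].
  by apply: le_trans (hg _ (dist_le_diam x y) ht) _; rewrite lerDl.
have lower : (k%:R - q%:R) * Phi <= \sum_(y in M) \sum_(z | e y z) g (dist x z).
  apply: (@le_trans _ _ (\sum_(y in M) \sum_(z in M) (e y z)%:R * g (dist x z))).
    rewrite exchange_big mulr_sumr /=; apply: ler_sum => z zM.
    rewrite -mulr_suml; apply: ler_wpM2r => //.
    rewrite -natrB // -natr_sum ler_nat leq_subLR -(degreeE z).
    have -> : (\sum_(y in M) e y z)%N = #|[set y | e z y] :&: M|.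
      rewrite -sum1_card big_mkcond [RHS]big_mkcond /=; apply: eq_bigr => y _.
      by rewrite !inE esym andbC; case: (y \in M) => //=; case: (e z y).
    rewrite -(cardsID M) addnC leq_add2r; apply: leq_trans (hM z zM).
    by rewrite (_ : _ :\: _ = [set y | e z y & y \notin M]) //;
      apply/setP => y; rewrite !inE andbC.
  apply: ler_sum => y _; rewrite big_mkcond [leRHS]big_mkcond /=.
  apply: ler_sum => z _; case: (z \in M); case: (e y z);
    by rewrite ?mul1r ?mul0r //.
have step : (k%:R - q%:R - rho) * Phi <= D * #|M|%:R.
  by rewrite mulrBl lerBlDl; apply: le_trans upper.
by apply: le_trans step; apply: ler_wpM2l.
Qed.

(** * Isoperimetry and motion under a dominant distance *)

Section GapMotion.
Variables (t Q : nat).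
Hypotheses (d_ge3 : (3 <= d)%N) (t_le_d : (t <= d)%N).
Hypothesis (Q_large : (256 * (d ^ 4) ^ 2 <= Q)%N).
Hypothesis dominant : (Q * (n - valency t) <= valency t)%N.

Local Notation N := (d ^ 4)%N.
Local Notation K := (16 * N)%N.

Let Q_large' : (100 * d <= Q)%N.
Proof.
apply: leq_trans Q_large; rewrite -expnM leq_mul //.
by rewrite -{1}(expn1 d) leq_exp2l //; lia.
Qed.

Let N_gt0 : (0 < N)%N. Proof. by rewrite expn_gt0; lia. Qed.

Let t_ge2 := dominant_ge2 d_ge3 t_le_d Q_large' dominant.

(* Largest at distance [t] and decaying geometrically away from it, so that off distance [t] the adjacency operator multiplies [green] by at most [flow_rate < k - max (a 1) (c 2)]. *)
Definition weight i : R :=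
  K%:R ^+ (if (i <= t)%N then (d + i)%N else (d + t.*2 - i)%N).

Lemma weight_gt0 i : 0 < weight i.
Proof. by apply: exprn_gt0; rewrite ltr0n; lia. Qed.

Lemma weight_up i : (i < t)%N -> weight i.+1 = K%:R * weight i.
Proof. by move=> h; rewrite /weight h (ltnW h) addnS exprS. Qed.

Lemma weight_down i : (t <= i)%N -> (i < d)%N -> weight i = K%:R * weight i.+1.
Proof.
move=> h hd; rewrite /weight -exprS; congr (_ ^+ _).
by case: ifP; case: ifP; lia.
Qed.

Definition green i : R := weight i / (valency i)%:R.

(** The transposed intersection matrix applied to [weight]. Dividing by sphere sizes turns it into
    the adjacency operator on [green], since [b i * valency i = c i.+1 * valency i.+1]. *)
Definition weight_flow i : R :=
  (if i is j.+1 then (b j)%:R * weight j else 0) + (a i)%:R * weight i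
  + (if (i < d)%N then (c i.+1)%:R * weight i.+1 else 0).

Lemma green_flow i : (i <= d)%N ->
  green i.-1 *+ c i + green i *+ a i + green i.+1 *+ b i
  = weight_flow i / (valency i)%:R.
Proof.
move=> id; have Vi := lt0r_neq0 (valency_natr_gt0 id).
rewrite -[green i.-1 *+ _]mulr_natl -[green i *+ _]mulr_natl -[green i.+1 *+ _]mulr_natl.
rewrite /weight_flow /green !mulrDl; congr (_ + _ + _).
- case: i id Vi => [|i] id Vi /=.
    have := intersection_sum id; rewrite mul0r => h.
    by rewrite (_ : c 0 = 0%N) ?mul0r //; lia.
  have V0 := lt0r_neq0 (valency_natr_gt0 (ltnW id)).
  have := congr1 (fun m => m%:R : R) (valency_edges i); rewrite /= !natrM => E.
  apply: (mulIf Vi); rewrite divfK //; apply: (mulIf V0).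
  have -> : (c i.+1)%:R * (weight i / (valency i)%:R) * (valency i.+1)%:R * (valency i)%:R
    = weight i * ((c i.+1)%:R * (valency i.+1)%:R) * ((valency i)%:R / (valency i)%:R).
    by ring.
  by rewrite divff // mulr1 -E; ring.
- by rewrite mulrA.
case: ifP => h; last first.
  have -> : i = d by lia.
  by rewrite b_diam !mul0r.
have V0 := lt0r_neq0 (valency_natr_gt0 h).
have := congr1 (fun m => m%:R : R) (valency_edges i); rewrite /= !natrM => E.
apply: (mulIf Vi); rewrite divfK //; apply: (mulIf V0).
have -> : (b i)%:R * (weight i.+1 / (valency i.+1)%:R) * (valency i)%:R * (valency i.+1)%:R
  = weight i.+1 * ((b i)%:R * (valency i)%:R) * ((valency i.+1)%:R / (valency i.+1)%:R).
  by ring.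
by rewrite divff // mulr1 E; ring.
Qed.

Definition flow_rate : R := k%:R * (1 - 13 / (8 * N%:R)).

(** [Q] is at least [K ^ 2]: one factor absorbs the growth of [weight] towards [t], the other leaves
    a term of order [k / K]. *)
Lemma K_sq_mul_le m : (Q * m <= k)%N -> (K * (K * m) <= k)%N.
Proof.
apply: leq_trans; rewrite mulnA leq_mul2r; apply/orP; right.
by apply: leq_trans Q_large; rewrite mulnACA.
Qed.

Lemma natrKw (m : nat) (w : R) : 0 <= w -> (K * (K * m) <= k)%N ->
  K%:R * (m%:R * (K%:R * w)) <= k%:R * w.
Proof.
move=> w0 h; rewrite [m%:R * _]mulrCA !mulrA; apply: ler_wpM2r => //.
by rewrite -!natrM ler_nat -mulnA.
Qed.

Lemma natrw (m : nat) (w : R) : 0 <= w -> (m <= k)%N ->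
  K%:R * (m%:R * w) <= k%:R * (K%:R * w).
Proof.
move=> w0 h; rewrite mulrCA; apply: ler_wpM2r; last by rewrite ler_nat.
by apply: mulr_ge0 => //; rewrite ler0n.
Qed.

Lemma bc_le_k i : (i <= d)%N -> (b i <= k)%N /\ (c i <= k)%N.
Proof. by move/intersection_sum; lia. Qed.

(** From below, the weight is smaller by the factor [K]; from above it is larger by [K], but
    [c i.+1 <= k / Q]. The gap in [b t.-1] bounds [a i]. Beyond [t] the roles of [b] and [c] are
    exchanged. *)
Lemma weight_flow_up i : (i < t)%N ->
  weight_flow i <= flow_rate * weight i.
Proof.
move=> it; have w0 j : 0 <= weight j := ltW (weight_gt0 j).
have kw0 : 0 <= k%:R * weight i :> R by rewrite mulr_ge0 ?ler0n.
apply: (@flow_arith _ N%:R K%:R); rewrite ?ltr0n //.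
- by rewrite natrM.
- case: i it kw0 => [|i] it kw0; first by rewrite mulr0.
  by rewrite weight_up ?(ltnW it) // natrw //; have [] := @bc_le_k i; lia.
- rewrite ifT; last by lia.
  rewrite weight_up // natrKw // K_sq_mul_le //.
  by apply: (dominant_c_le d_ge3 t_le_d Q_large' dominant); lia.
have gap := gap_b d_ge3 t_le_d Q_large' dominant.
have hb : (b t.-1 <= b i)%N by apply: b_decr; lia.
have hs := @intersection_sum i ltac:(lia).
have h : (4 * N * a i + 7 * k <= 4 * N * k)%N.
  by move: gap; move: N (b t.-1) hb => N' B hb; nia.
by move: h; rewrite -(ler_nat R) natrD !natrM; lra.
Qed.

Lemma weight_flow_down i : (t < i)%N -> (i <= d)%N ->
  weight_flow i <= flow_rate * weight i.
Proof.
move=> it id; have w0 j : 0 <= weight j := ltW (weight_gt0 j).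
have kw0 : 0 <= k%:R * weight i :> R by rewrite mulr_ge0 ?ler0n.
apply: (@flow_arith _ N%:R K%:R); rewrite ?ltr0n //.
- by rewrite natrM.
- case: i it id kw0 => [//|i] it id kw0.
  rewrite (@weight_down i) // natrKw // K_sq_mul_le //.
  apply: leq_trans (dominant_b d_ge3 t_le_d Q_large' dominant).
  by rewrite leq_mul2l b_decr ?orbT //; lia.
- case: ifP => idd; last by rewrite mulr0.
  by rewrite (@weight_down i) ?(ltnW it) // natrw //; have [] := @bc_le_k i.+1.
have gap := gap_c d_ge3 t_le_d Q_large' dominant ltac:(lia).
have hc : (c t.+1 <= c i)%N by apply: c_incr; lia.
have hs := @intersection_sum i id.
have h : (4 * N * a i + 7 * k <= 4 * N * k)%N.
  by move: gap; move: N (c t.+1) hc => N' B hb; nia.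
by move: h; rewrite -(ler_nat R) natrD !natrM; lra.
Qed.

Lemma weight_flow_top : weight_flow t <= 3 * k%:R * weight t.
Proof.
have w0 j : 0 <= weight j := ltW (weight_gt0 j).
have K1 : 1 <= K%:R :> R by rewrite (ler_nat _ 1); lia.
have -> : 3 * k%:R * weight t = k%:R * weight t + k%:R * weight t + k%:R * weight t.
  by ring.
apply: lerD; first apply: lerD.
- have -> : t = t.-1.+1 by lia.
  rewrite (@weight_up t.-1) ?prednK ?(ltnW t_ge2) //.
  apply: ler_pM; rewrite ?ler0n //.
    by rewrite ler_nat; have [] := @bc_le_k t.-1; lia.
  by rewrite ler_peMl.
- by apply: ler_wpM2r => //; rewrite ler_nat; have := @intersection_sum t; lia.
case: ifP => td; last by rewrite mulr_ge0 ?ler0n.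
rewrite (@weight_down t) //; apply: ler_pM; rewrite ?ler0n //.
  by rewrite ler_nat; have [] := @bc_le_k t.+1.
by rewrite ler_peMl.
Qed.

Lemma gap_isoperimetry (M : {set 'I_n}) x : (2 * N * a 1 < 3 * k)%N ->
    (forall y, y \in M -> (#|[set z | e y z & z \notin M]| <= maxn (a 1) (c 2))%N) ->
    x \in M ->
  (n <= 48 * N * K ^ d * #|M|)%N.
Proof.
move=> small_a hM xM; set q := maxn _ _ in hM.
have k0 : (0 < k)%N by apply: b_gt0; lia.
have kR : 0 < k%:R :> R by rewrite ltr0n.
have NR : 0 < N%:R :> R by rewrite ltr0n.
have N1 : 2 <= N%:R :> R.
  by rewrite (ler_nat _ 2) (@leq_trans (3 ^ 4)) // leq_exp2r.
have hq : (2 * N * q <= 3 * k)%N.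
  rewrite /q /maxn; case: ifP => _; last by lia.
  have := @dominant_c_le t Q d_ge3 t_le_d Q_large' dominant 2 0.
  rewrite t_ge2 => /(_ isT ltac:(lia)) => h.
  apply: (@leq_trans (Q * c 2)); last by lia.
  rewrite leq_mul2r; apply/orP; right; apply: leq_trans Q_large.
  by move: N N_gt0 => N' N0; nia.
have hqR : q%:R <= k%:R * (3 / (2 * N%:R)) :> R.
  rewrite mulrA ler_pdivlMr; last by lra.
  by move: hq; rewrite -(ler_nat R) !natrM; lra.
have qk : (q <= k)%N by move: hq (N_gt0) N1; rewrite (ler_nat _ 2); nia.
(* [q] takes at most [12 / (8 N)] of [k], and [flow_rate] leaves [13 / (8 N)]. *)
have slack : k%:R / (8 * N%:R) <= k%:R - q%:R - flow_rate.
  have -> : k%:R / (8 * N%:R) = k%:R - k%:R * (3 / (2 * N%:R)) - flow_rate.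
    rewrite /flow_rate; move: NR; move: (N%:R : R) => N' NR'; field; lra.
  by lra.
have slack0 : 0 <= k%:R / (8 * N%:R) :> R by rewrite divr_ge0 //; lra.
have rate0 : 0 <= flow_rate.
  rewrite mulr_ge0 ?ler0n // subr_ge0 ler_pdivrMr; lra.
have g0 i : 0 <= green i by rewrite divr_ge0 ?ler0n // ltW // weight_gt0.
pose D := 3 * k%:R * weight t / (valency t)%:R.
have w0 := ltW (weight_gt0 t).
have D0 : 0 <= D by rewrite divr_ge0 ?ler0n // !mulr_ge0 ?ler0n.
have := @weighted_isoperimetry green flow_rate D t M q x g0 D0 qk _ _ hM xM
  (le_trans slack0 slack).
have hi i : (i <= d)%N -> i != t ->
    green i.-1 *+ c i + green i *+ a i + green i.+1 *+ b i <= flow_rate * green i.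
  move=> id it; rewrite green_flow // /green mulrA.
  apply: ler_wpM2r; first by rewrite invr_ge0 ler0n.
  by case: (ltngtP i t) it => // it _; [apply: weight_flow_up|apply: weight_flow_down].
(* At distance [t] the whole flow is charged to [D]. *)
have ht : green t.-1 *+ c t + green t *+ a t + green t.+1 *+ b t
    <= flow_rate * green t + D.
  rewrite green_flow //; apply: ler_wpDl; first by rewrite mulr_ge0.
  by apply: ler_wpM2r; rewrite ?invr_ge0 ?ler0n // weight_flow_top.
move=> /(_ hi ht).
have -> : green 0 = K%:R ^+ d by rewrite /green /weight /= addn0 divr1.
have VR := valency_natr_gt0 t_le_d.
have K0 : (0 < K)%N by rewrite muln_gt0.
have Kd : 0 < K%:R ^+ d :> R by rewrite exprn_gt0 // ltr0n.
move=> main.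
have {}main : k%:R / (8 * N%:R) * K%:R ^+ d <= D * #|M|%:R.
  by apply: le_trans main; rewrite ler_pM2r.
have wt : weight t = K%:R ^+ d * K%:R ^+ t by rewrite /weight leqnn exprD.
have Vle : (valency t)%:R <= 24 * N%:R * K%:R ^+ t * #|M|%:R :> R.
  move: main; rewrite /D wt; move: Kd NR VR kR; move: (K%:R ^+ d) (K%:R ^+ t).
  move: (N%:R : R) (#|M|%:R : R) (k%:R : R) ((valency t)%:R : R).
  exact: isoperimetry_arith.
have VN : (valency t <= 24 * N * K ^ t * #|M|)%N.
  by move: Vle; rewrite -natrX -!natrM ler_nat.
have Kt : (K ^ t <= K ^ d)%N by rewrite leq_pexp2l.
have nV : (n <= 2 * valency t)%N.
  rewrite mul2n -addnn -leq_subLR; apply: leq_trans dominant.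
  apply: leq_pmull; apply: leq_trans Q_large'.
  by rewrite muln_gt0 (ltn_trans _ d_ge3).
apply: (leq_trans nV); apply: (@leq_trans (2 * (24 * N * K ^ t * #|M|))).
  by rewrite leq_mul2l.
by move: N (K ^ t)%N (K ^ d)%N Kt => N' Kt' Kd' le_K; rewrite !mulnA !leq_mul.
Qed.

(** Take for [M] the set of moved vertices: a fixed neighbour of a moved [y] is a common neighbour
    of [y] and [s y]. *)
Lemma gap_motion (s : {perm 'I_n}) x : (2 * N * a 1 < 3 * k)%N ->
    is_aut e s -> s x != x ->
  (n <= 48 * N * K ^ d * #|[set v | s v != v]|)%N.
Proof.
move=> small_a hs sx; apply: (@gap_isoperimetry _ x) => //; last by rewrite inE.
move=> y; rewrite inE eq_sym => hy; apply: leq_trans (common_neighbors_le hy).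
apply: subset_leq_card; apply/subsetP => z; rewrite !inE negbK.
by move=> /andP[eyz /eqP hz]; rewrite eyz -hz hs.
Qed.

End GapMotion.

End DistanceRegular.

(** * Clique geometries *)

Section CliqueGeometry.
Variables (n : nat) (e : rel 'I_n) (k la mu N : nat).
Hypotheses (esym : symmetric e) (eirr : irreflexive e).
Hypothesis degree : forall v, #|[set x | e v x]| = k.
Hypothesis common_adj : forall u v, e u v -> #|[set z | e u z & e v z]| = la.
Hypothesis common_nonadj : forall u v, u != v -> ~~ e u v ->
  #|[set z | e u z & e v z]| <= mu.
Hypotheses (k_gt0 : 0 < k) (mu_gt0 : 0 < mu) (N_gt0 : 0 < N).
Hypothesis la_large : 3 * k <= 2 * N * la.
Hypothesis mu_small : 100 * N ^ 2 * mu <= la.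
Implicit Types (u v w x y z : 'I_n) (C I : {set 'I_n}).

Let la_mu : 100 * mu <= la.
Proof.
by apply: leq_trans mu_small; rewrite -mulnA leq_mul2l leq_pmull // expn_gt0 N_gt0.
Qed.

Let la_Nmu : 100 * (N * mu) <= la.
Proof.
apply: leq_trans mu_small; by rewrite -mulnA -mulnn !leq_mul // leq_pmull.
Qed.

Let la_NNmu : 100 * (N * (N * mu)) <= la.
Proof. by apply: leq_trans mu_small; rewrite -mulnn !mulnA. Qed.

Definition cliqueb C := [forall u in C, forall v in C, (u != v) ==> e u v].

Lemma cliquebP C : reflect (clique e C) (cliqueb C).
Proof.
apply: (iffP forall_inP) => [h u v uC vC uv|h u uC].
  by have /forall_inP/(_ v vC)/implyP := h u uC; apply.
by apply/forall_inP => v vC; apply/implyP; apply: h.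
Qed.

(** By maximality [u] misses some [w] in [C], so its neighbours in [C] are common neighbours of the
    nonadjacent [u] and [w]. *)
Lemma maxclique_neighbors C u : maxset cliqueb C -> u \notin C ->
  #|[set x in C | e u x]| <= mu.
Proof.
move=> /maxsetP[/cliquebP clC maxC] uC.
have [w wC uw] : exists2 w, w \in C & ~~ e u w.
  apply/exists_inP; rewrite -[X in is_true X]negbK negb_exists_in.
  apply/negP => /forall_inP all_adj.
  have cl : cliqueb (u |: C).
    apply/cliquebP => x y; rewrite !inE => /predU1P[->|xC] /predU1P[->|yC] xy.
    - by rewrite eqxx in xy.
    - by have := all_adj _ yC; rewrite negbK.
    - by have := all_adj _ xC; rewrite negbK esym.
    by apply: clC.
  have := maxC _ cl (subsetUr _ _) => E.
  by rewrite -E setU11 in uC.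
have uw' : u != w by apply: contraNneq uC => ->.
apply: leq_trans (common_nonadj uw' uw); apply: subset_leq_card.
apply/subsetP => x; rewrite !inE => /andP[xC eux]; rewrite eux /=.
by apply: clC => //; apply: contraNneq uw => ->.
Qed.

(** The threshold [2 / 3 * la] is low enough for the cliques of size about [la] found below, and
    high enough that two distinct lines cannot share an edge. *)
Definition lines : {set {set 'I_n}} :=
  [set C | maxset cliqueb C && (2 * la <= 3 * #|C|)].

Lemma line_clique C : C \in lines -> clique e C.
Proof. by rewrite inE => /andP[/maxsetp/cliquebP]. Qed.

(** Both cliques lie in [u], [v] and their [la] common neighbours, while their union has at least
    [4 / 3 * la - mu] vertices. *)
Lemma line_unique C C' u v : C \in lines -> C' \in lines -> u != v ->
  u \in C -> v \in C -> u \in C' -> v \in C' -> C = C'.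
Proof.
move=> CS C'S uv uC vC uC' vC'; apply/eqP/negPn/negP => neq.
have clC := line_clique CS; have clC' := line_clique C'S.
move: CS C'S; rewrite !inE => /andP[maxC szC] /andP[maxC' szC'].
have [z zC' zC] : exists2 z, z \in C' & z \notin C.
  apply/subsetPn; apply: contra neq => sub.
  by have /maxsetP[_ /(_ C (maxsetp maxC) sub) ->] := maxC'.
have hI : #|C :&: C'| <= mu.
  apply: leq_trans (maxclique_neighbors maxC zC); apply: subset_leq_card.
  apply/subsetP => x; rewrite !inE => /andP[xC xC']; rewrite xC /=.
  by apply: clC' => //; apply: contraNneq zC => ->.
have hU : #|C :|: C'| <= la + 2.
  (* [cards2] has the form [(u != v).+1], so the 2 is rewritten to match. *)
  rewrite -(common_adj (clC _ _ uC vC uv)) -[2]/(true.+1) -uv -cards2.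
  apply: leq_trans (leq_card_setU _ _); apply: subset_leq_card.
  apply/subsetP => x; rewrite !inE.
  case: (eqVneq x u) => [->|xu]; first by rewrite /= orbT.
  case: (eqVneq x v) => [->|xv]; first by rewrite /= orbT.
  rewrite /= orbF; case/orP => xC.
    by rewrite !clC // eq_sym.
  by rewrite !clC' // eq_sym.
by have := cardsUI C C'; move: hI hU szC szC' la_mu mu_gt0; clear; lia.
Qed.

(** * Cliques in the neighbourhood of a vertex *)

Section LocalClique.
Variable v : 'I_n.

Definition independent I :=
  (I \subset [set x | e v x]) && [forall x in I, forall y in I, ~~ e x y].

Lemma independentP I : reflect
  ({in I, forall x, e v x} /\ {in I &, forall x y, ~~ e x y}) (independent I).
Proof.
apply: (iffP andP) => -[h1 h2]; split.
- by move=> x xI; have := subsetP h1 x xI; rewrite inE.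
- by move=> x y xI yI; have /forall_inP/(_ y yI) := forall_inP h2 x xI.
- by apply/subsetP => x xI; rewrite inE h1.
by apply/forall_inP => x xI; apply/forall_inP => y yI; apply: h2.
Qed.

(* Counting the pairs [(y, z)] with [y] in [I] adjacent to [z] by multiplicity [m_z <= 1 + m_z (m_z - 1)]. *)
Lemma independent_count I : independent I -> #|I| * la <= k + #|I| * (#|I| * mu).
Proof.
move=> /independentP[Iv Iind].
pose m z := \sum_(y in I) (e y z : nat).
have count : \sum_(z | e v z) m z = #|I| * la.
  rewrite exchange_big /= -sum_nat_const; apply: eq_bigr => y yI.
  rewrite -(common_adj (Iv y yI)) -sum1_card big_mkcond [RHS]big_mkcond /=.
  by apply: eq_bigr => z _; rewrite inE; case: (e v z); case: (e y z).
have msq z : m z <= 1 + \sum_(y in I) \sum_(y' in I | y' != y) (e y z && e y' z : nat).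
  case: (boolP [exists y in I, e y z]) => [/exists_inP[y0 y0I ey0]|].
    rewrite /m (bigD1 y0) //= ey0 leq_add2l.
    rewrite [leqRHS](bigD1 y0) //=; apply: leq_trans (leq_addr _ _).
    by apply: leq_sum => y _; rewrite ey0.
  move/exists_inPn => none; rewrite /m big1 // => y yI.
  by rewrite (negbTE (none y yI)).
have pairs : \sum_(z | e v z) \sum_(y in I) \sum_(y' in I | y' != y)
     (e y z && e y' z : nat) <= #|I| * (#|I| * mu).
  rewrite exchange_big /= -sum_nat_const; apply: leq_sum => y yI.
  rewrite exchange_big /= -sum_nat_const.
  apply: (@leq_trans (\sum_(y' in I | y' != y) mu)); last first.
    by rewrite [leqRHS](bigD1 y) //= leq_addl.
  apply: leq_sum => y' /andP[y'I y'y].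
  have yy' : y != y' by rewrite eq_sym.
  apply: leq_trans (common_nonadj yy' (Iind _ _ yI y'I)).
  rewrite -sum1_card big_mkcond [leqRHS]big_mkcond /=; apply: leq_sum => z _.
  by rewrite inE; case: (e v z); case: (e y z); case: (e y' z).
rewrite -count; apply: (@leq_trans (\sum_(z | e v z) (1 + \sum_(y in I)
  \sum_(y' in I | y' != y) (e y z && e y' z : nat)))).
  by apply: leq_sum.
rewrite big_split /= leq_add // sum1_card -(degree v) cardsE.
exact: leqnn.
Qed.

(** The quadratic count fails at size exactly [N], and a larger independent set contains one of that
    size. *)
Lemma independent_small I : independent I -> #|I| < N.
Proof.
move=> indI; rewrite ltnNge; apply/negP => NI.
have [J JI cJ] : exists2 J : {set 'I_n}, J \subset I & #|J| = N.
  have /card_gt0P[J] : 0 < #|[set J : {set 'I_n} | (J \subset I) && (#|J| == N)]|.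
    by rewrite cards_draws bin_gt0.
  by rewrite inE => /andP[sub /eqP]; exists J.
have indJ : independent J.
  have /independentP[h1 h2] := indI; apply/independentP; split.
    by move=> x /(subsetP JI); apply: h1.
  by move=> x y /(subsetP JI) xI /(subsetP JI); apply: h2.
have := independent_count indJ; rewrite cJ; move: la_large la_NNmu la_mu mu_gt0.
have : la <= N * la by rewrite leq_pmull.
by rewrite -mulnA; clear; lia.
Qed.

Variable I : {set 'I_n}.
Hypothesis indI : independent I.
Hypothesis maxI : forall J, independent J -> #|J| <= #|I|.

Let Iv : {in I, forall x, e v x}. Proof. by have /independentP[] := indI. Qed.
Let Iind : {in I &, forall x y, ~~ e x y}.
Proof. by have /independentP[] := indI. Qed.

(** The vertex [y] and those neighbours of [v] whose only neighbour in [I] is [y]. *)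
Definition private y : {set 'I_n} :=
  [set z | [&& e v z, (z == y) || e y z & [forall y' in I :\ y, ~~ e y' z]]].

(** Two nonadjacent members could replace [y] in [I], against its maximality. *)
Lemma private_clique y : y \in I -> clique e (private y).
Proof.
move=> yI z z'; rewrite !inE => /and3P[vz hz pz] /and3P[vz' hz' pz'] zz'.
case/predU1P: hz => [zy|yz].
  by case/predU1P: hz' => [z'y|]; [rewrite zy z'y eqxx in zz' | rewrite zy].
case/predU1P: hz' => [->|yz']; first by rewrite esym.
apply/negPn/negP => nadj.
have zI : z \notin I by apply/negP => zI; have := Iind yI zI; rewrite yz.
have z'I : z' \notin I by apply/negP => zI'; have := Iind yI zI'; rewrite yz'.
have pz1 x : x \in I :\ y -> ~~ e x z by move=> /(forall_inP pz).
have pz1' x : x \in I :\ y -> ~~ e x z' by move=> /(forall_inP pz').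
have indJ : independent (z |: (z' |: I :\ y)).
  apply/independentP; split.
    by move=> x /setU1P[->//|/setU1P[->//|/setD1P[_ /Iv]]].
  move=> x1 x2 /setU1P[->|/setU1P[->|h1]] /setU1P[->|/setU1P[->|h2]];
    rewrite ?eirr //; try by rewrite ?(esym z' z).
  - by rewrite esym pz1.
  - by rewrite esym pz1'.
  - exact: pz1.
  - exact: pz1'.
  by apply: Iind; [case/setD1P: h1|case/setD1P: h2].
have := maxI indJ; rewrite (cardsD1 y I) yI !cardsU1 !inE.
by rewrite (negbTE zI) (negbTE z'I) !andbF !orbF zz' /= !add1n ltnn.
Qed.

Lemma nonprivate_small y : y \in I ->
  #|[set z | [&& e v z, e y z & z \notin private y]]| <= N * mu.
Proof.
move=> yI.
apply: (@leq_trans (\sum_(y' in I :\ y) #|[set z | e y z & e y' z]|)).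
  apply: (@leq_trans #|\bigcup_(y' in I :\ y) [set z | e y z & e y' z]|).
    apply: subset_leq_card; apply/subsetP => z; rewrite !inE => /and3P[vz yz].
    rewrite vz yz orbT /= negb_forall => /existsP[y'].
    rewrite negb_imply negbK => /andP[y'I y'z].
    by apply/bigcupP; exists y' => //; rewrite inE yz.
  elim/big_rec2: _ => [|y' m A _ h]; first by rewrite cards0.
  by apply: leq_trans (leq_card_setU _ _) _; rewrite leq_add2l.
apply: (@leq_trans (\sum_(y' in I :\ y) mu)).
  apply: leq_sum => y' /setD1P[yy' y'I]; apply: common_nonadj.
    by rewrite eq_sym.
  exact: Iind.
rewrite sum_nat_const leq_mul2r; apply/orP; right.
by apply: leq_trans (ltnW (independent_small indI)); apply: subset_leq_card (subsetDl _ _).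
Qed.

Lemma private_large y : y \in I -> la <= #|private y| + N * mu.
Proof.
move=> yI; rewrite -(common_adj (Iv yI)).
apply: leq_trans (_ : _ <= #|private y| + #|[set z | [&& e v z, e y z & z \notin private y]]|) _.
  apply: leq_trans (leq_card_setU _ _); apply: subset_leq_card.
  apply/subsetP => z; rewrite inE => /andP[vz yz]; rewrite in_setU.
  by case: (boolP (z \in private y)) => //= h; rewrite inE vz yz.
by rewrite leq_add2l nonprivate_small.
Qed.

Lemma independent_dominates u : e v u -> exists2 y, y \in I & (u == y) || e y u.
Proof.
move=> vu; case: (boolP (u \in I)) => uI; first by exists u; rewrite ?eqxx.
apply/exists_inP; apply: contraT => /exists_inPn none.
have none1 y : y \in I -> ~~ e y u by move=> /none /norP[].
have indJ : independent (u |: I).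
  apply/independentP; split; first by move=> x /setU1P[->//|/Iv].
  move=> x1 x2 /setU1P[->|h1] /setU1P[->|h2]; rewrite ?eirr //.
  - by rewrite esym none1.
  - exact: none1.
  exact: Iind.
by have := maxI indJ; rewrite cardsU1 uI ltnn.
Qed.

(** The [la] common neighbours of [u] and [v] are, up to few exceptions, spread over fewer than [N]
    private cliques, so [u] has more than [mu] neighbours in one of them. A member of it not
    adjacent to [u] would have too many common neighbours with [u]. *)
Lemma edge_private u : e v u ->
  exists2 y, y \in I & clique e (v |: (u |: private y)).
Proof.
move=> vu.
have [y yI big_y] : exists2 y, y \in I & mu < #|[set z in private y | e u z]|.
  apply/exists_inP; apply: contraT => /exists_inPn small; suff: False by [].
  have : la <= \sum_(y in I) (#|[set z in private y | e u z]| +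
      #|[set z | [&& e v z, e y z & z \notin private y]]|).
    rewrite -(common_adj vu).
    apply: (@leq_trans #|\bigcup_(y in I) ([set z in private y | e u z] :|:
        [set z | [&& e v z, e y z & z \notin private y]])|).
      apply: subset_leq_card; apply/subsetP => z; rewrite inE => /andP[vz uz].
      have [y yI hy] := independent_dominates vz.
      apply/bigcupP; exists y => //; rewrite in_setU.
      case: (boolP (z \in private y)) => zp.
        by apply/orP; left; apply/setIdP.
      apply/orP; right; rewrite in_set vz zp /= andbT.
      case/predU1P: hy => // zy; case/negP: zp; rewrite zy inE Iv // eqxx /=.
      by apply/forall_inP => y' /setD1P[_ y'I]; apply: Iind.
    elim/big_rec2: _ => [|y m A _ h]; first by rewrite cards0.
    apply: leq_trans (leq_card_setU _ _) _; apply: leq_add => //.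
    exact: leq_card_setU.
  apply/negP; rewrite -ltnNge.
  apply: (@leq_ltn_trans (\sum_(y in I) (mu + N * mu))).
    apply: leq_sum => y yI; apply: leq_add; last exact: nonprivate_small.
    by have := small y yI; rewrite -leqNgt.
  rewrite sum_nat_const; apply: (@leq_ltn_trans (N * (mu + N * mu))).
    by rewrite leq_mul2r ltnW ?orbT // independent_small.
  rewrite mulnDr; move: la_NNmu la_Nmu la_mu mu_gt0; clear; lia.
exists y => //; have clp := private_clique yI.
have vp x : x \in private y -> e v x by rewrite inE => /and3P[].
have up x : x \in private y -> x != u -> e u x.
  move=> xp xu; apply/negPn/negP => nadj.
  have ux : u != x by rewrite eq_sym.
  have := common_nonadj ux nadj; rewrite leqNgt => /negP; apply.
  apply: leq_trans big_y _; apply: subset_leq_card; apply/subsetP => z.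
  case/setIdP=> zp uz; rewrite in_set uz /=.
  by apply: clp => //; apply: contraNneq nadj => ->.
move=> x1 x2 /setU1P[->|/setU1P[->|h1]] /setU1P[->|/setU1P[->|h2]];
  rewrite ?eqxx // => neq.
- exact: vp.
- by rewrite esym.
- by apply: up; rewrite // eq_sym.
- by rewrite esym vp.
- by rewrite esym up.
exact: clp.
Qed.

End LocalClique.

(** A maximal clique above the one from [edge_private] has at least [la - N * mu] vertices, which
    passes the threshold. *)
Lemma edge_in_line u v : e v u -> exists2 C, C \in lines & (v \in C) && (u \in C).
Proof.
move=> vu.
have ind0 : independent v set0.
  by apply/independentP; split=> [x|x y]; rewrite inE.
case: (arg_maxnP (fun I : {set 'I_n} => #|I|) ind0) => I indI maxI.
have [y yI /cliquebP clq] := edge_private indI maxI vu.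
have [C maxC sub] := maxset_exists clq.
exists C; last by rewrite !(subsetP sub) // !inE eqxx ?orbT.
rewrite inE maxC /=.
have : #|private v I y| <= #|C|.
  apply: subset_leq_card; apply: subset_trans sub.
  by rewrite setUA subsetUr.
have := private_large indI yI; move: la_Nmu la_mu mu_gt0.
by move: #|private v I y| #|C|; clear; lia.
Qed.

Lemma edge_in_one_line u v : e u v ->
  #|[set C in lines | (u \in C) && (v \in C)]| = 1.
Proof.
move=> uv; have [C CS /andP[uC vC]] := edge_in_line uv.
have neq : u != v by apply: contraTneq uv => ->; rewrite eirr.
apply/eqP/cards1P; exists C; apply/setP => C'; rewrite in_set in_set1.
apply/and3P/eqP => [[C'S uC' vC']|-> //].
exact: (line_unique C'S CS neq).
Qed.

(** * Number and size of lines *)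

Definition lines_through v : {set {set 'I_n}} := [set C in lines | v \in C].

Lemma sum_line_degree v : \sum_(C in lines_through v) #|C|.-1 = k.
Proof.
transitivity (\sum_(C in lines_through v) \sum_(x | e v x) (x \in C : nat)).
  apply: eq_bigr => C; rewrite inE => /andP[CS vC].
  have := cardsD1 v C; rewrite vC add1n => -> /=.
  rewrite -sum1_card big_mkcond [RHS]big_mkcond /=; apply: eq_bigr => x _.
  rewrite !inE; case: (boolP (x \in C)) => xC; last by rewrite andbF; case: (e v x).
  rewrite andbT; case: eqVneq => [->|xv]; first by rewrite eirr.
  by rewrite (line_clique CS) // eq_sym.
rewrite exchange_big /= -(degree v) cardsE -sum1_card; apply: eq_bigr => x vx.
rewrite -(edge_in_one_line vx) -sum1_card big_mkcond [RHS]big_mkcond /=.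
apply: eq_bigr => C _; rewrite /lines_through !in_set.
by case: (_ && (2 * la <= _)); case: (v \in C); case: (x \in C).
Qed.

Lemma line_size C : C \in lines -> 2 * la <= 3 * #|C|.
Proof. by rewrite inE => /andP[]. Qed.

(** A first bound from [#|C|.-1 >= la / 3]; it is needed for [line_size_lower], which later sharpens
    it to [N]. *)
Lemma card_lines_through_le v : #|lines_through v| <= 2 * N.
Proof.
have : #|lines_through v| * la <= 3 * k.
  rewrite -(sum_line_degree v) big_distrr /= -sum_nat_const; apply: leq_sum => C.
  rewrite inE => /andP[/line_size + _]; move: la_mu mu_gt0; move: #|C|; clear; lia.
have la0 : 0 < la by move: la_mu mu_gt0; clear; lia.
by move=> /leq_trans/(_ la_large); rewrite leq_pmul2r.
Qed.

Lemma line_other_vertex C v : C \in lines -> exists2 u, u \in C & u != v.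
Proof.
move=> CS; have : 0 < #|C :\ v|.
  have := cardsD1 v C; have := line_size CS.
  move: la_mu mu_gt0; move: #|C| #|C :\ v|.
  by case: (v \in C); clear; lia.
by case/card_gt0P => u /setD1P[]; exists u.
Qed.

Lemma line_size_upper C v : C \in lines -> v \in C -> #|C|.-1 <= la + 1.
Proof.
move=> CS vC; have [u uC uv] := line_other_vertex v CS.
have clC := line_clique CS.
rewrite -(common_adj (clC _ _ uC vC uv)).
have -> : #|C| = #|C :\ v|.+1 by rewrite (cardsD1 v C) vC.
have -> : #|C :\ v| = #|C :\ v :\ u|.+1.
  by rewrite (cardsD1 u (C :\ v)) in_setD1 uv uC.
rewrite /= addn1 ltnS; apply: subset_leq_card; apply/subsetP => x.
by rewrite !inE => /and3P[xu xv xC]; rewrite !clC // eq_sym.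
Qed.

(** A common neighbour of [u] and [v] outside [C] is on another line through [v]. That line avoids
    [u], hence contains at most [mu] neighbours of [u]. *)
Lemma line_size_lower C v : C \in lines -> v \in C -> la <= #|C| + 2 * N * mu.
Proof.
move=> CS vC; have [u uC uv] := line_other_vertex v CS.
have clC := line_clique CS.
rewrite -(common_adj (clC _ _ uC vC uv)).
pose rest := \bigcup_(C' in lines_through v :\ C) [set x in C' | e u x].
apply: (@leq_trans (#|C| + #|rest|)).
  apply: leq_trans (leq_card_setU _ _); apply: subset_leq_card.
  apply/subsetP => x; rewrite !inE => /andP[ux vx].
  case: (boolP (x \in C)) => //= xC.
  have [C' C'S /andP[vC' xC']] := edge_in_line vx.
  apply/bigcupP; exists C'; last by rewrite inE xC' ux.
  apply/setD1P; split; last exact/setIdP.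
  by apply: contraNneq xC => <-.
rewrite leq_add2l.
apply: (@leq_trans (\sum_(C' in lines_through v :\ C) #|[set x in C' | e u x]|)).
  rewrite /rest; elim/big_rec2: _ => [|C' m A _ h]; first by rewrite cards0.
  by apply: leq_trans (leq_card_setU _ _) _; rewrite leq_add2l.
apply: (@leq_trans (\sum_(C' in lines_through v :\ C) mu)).
  apply: leq_sum => C' /setD1P[C'C]; rewrite inE => /andP[C'S vC'].
  apply: maxclique_neighbors; first by move: C'S; rewrite inE => /andP[].
  by apply: contraNN C'C => uC'; apply/eqP; apply: line_unique uv _ _ _ _.
rewrite sum_nat_const leq_mul2r; apply/orP; right.
apply: leq_trans (card_lines_through_le v); apply: subset_leq_card.
exact: subsetDl.
Qed.

Lemma card_lines_through_bounds v :
  #|lines_through v| * la <= k + #|lines_through v| * (2 * N * mu + 1) /\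
  k <= #|lines_through v| * (la + 1).
Proof.
split; last first.
  rewrite -{1}(sum_line_degree v) -sum_nat_const; apply: leq_sum => C.
  by rewrite inE => /andP[CS vC]; apply: line_size_upper vC.
rewrite -(sum_line_degree v) -!sum_nat_const -big_split /=; apply: leq_sum => C.
rewrite inE => /andP[CS vC]; have := line_size_lower CS vC.
by move: (2 * N * mu) #|C|; clear; lia.
Qed.

(* [#|lines_through v|] lies in a real interval around [k / la] that is too short to contain two integers. *)
Lemma card_lines_through_const u v : #|lines_through u| = #|lines_through v|.
Proof.
wlog lt : u v / #|lines_through u| < #|lines_through v|.
  move=> H; case: (ltngtP #|lines_through u| #|lines_through v|) => // h.
    exact: H.
  by symmetry; apply: H.
have [_ hu] := card_lines_through_bounds u.
have [hv _] := card_lines_through_bounds v.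
have := card_lines_through_le u; have := card_lines_through_le v.
have h1 : N <= N * mu by rewrite leq_pmulr.
have h2 : N * mu <= N * (N * mu) by rewrite leq_pmull.
have h3 : mu <= N * mu by rewrite leq_pmull.
move: la_NNmu mu_gt0 N_gt0 hu hv lt h1 h2 h3.
move: #|lines_through u| #|lines_through v| => p q; clear; move=> *; nia.
Qed.

Lemma card_lines_through_le_N v : #|lines_through v| <= N.
Proof.
have [hv _] := card_lines_through_bounds v.
have hN := card_lines_through_le v.
have h1 : N <= N * mu by rewrite leq_pmulr.
have h2 : N * mu <= N * (N * mu) by rewrite leq_pmull.
move: la_NNmu mu_gt0 N_gt0 hv hN h1 h2 la_large.
move: #|lines_through v| => p; clear => *; nia.
Qed.

Lemma card_lines_through_gt0 v : 0 < #|lines_through v|.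
Proof.
rewrite lt0n; apply: contraTneq k_gt0 => h.
rewrite -(sum_line_degree v) big1 // => C CS.
by move: h; rewrite (cardsD1 C) CS.
Qed.

(** Count incidences: a vertex is on at most [N] lines, while a line has at least [2 / 3 * la > N]
    vertices. This gives the incidence matrix a nonzero left kernel. *)
Lemma card_lines_lt : 0 < n -> #|lines| < n.
Proof.
move=> n0; have h : \sum_(C in lines) #|C| <= n * N.
  rewrite -[X in X * _](card_ord n) -sum_nat_const.
  have -> : \sum_(C in lines) #|C| = \sum_(v : 'I_n) #|lines_through v|.
    under [RHS]eq_bigr => v _ do rewrite -sum1_card big_mkcond /=.
    rewrite exchange_big [LHS]big_mkcond /=; apply: eq_bigr => C _.
    case: ifP => CS; last by rewrite big1 // => v _; rewrite inE CS.
    rewrite -sum1_card big_mkcond /=; apply: eq_bigr => v _.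
    by rewrite inE CS.
  by apply: leq_sum => v _; apply: card_lines_through_le_N.
have h' : #|lines| * (2 * la) <= 3 * (n * N).
  apply: (@leq_trans (3 * \sum_(C in lines) #|C|)); last by rewrite leq_mul2l.
  rewrite big_distrr /= -sum_nat_const; apply: leq_sum => C; exact: line_size.
rewrite ltnNge; apply/negP => le.
have h1 : N <= N * mu by rewrite leq_pmulr.
move: h' le h1 la_Nmu n0 N_gt0; move: #|lines| => L; clear => *; nia.
Qed.

End CliqueGeometry.

Local Open Scope ring_scope.

(** * Least eigenvalue and Delsarte cliques *)

Section DelsarteBound.
Variables (n : nat) (e : rel 'I_n.+1) (k : nat) (theta : algC).
Hypotheses (esym : symmetric e) (eirr : irreflexive e) (econ : connected e).
Hypothesis degree : forall v, #|[set x | e v x]| = k.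
Hypothesis inv_adj : forall M : 'M[algC]_n.+1,
  dist_invariant e M -> dist_invariant e (M *m adj e).
Hypotheses (k_gt0 : (0 < k)%N) (theta_eig : eigenvalue (adj e) theta).

Lemma dist_invariant_horner (M : 'M[algC]_n.+1) (q : {poly algC}) :
  dist_invariant e M -> dist_invariant e (M *m horner_mx (adj e) q).
Proof.
move=> hM; elim/poly_ind: q => [|q c IH].
  by rewrite raddf0 mulmx0; exists (fun _ => 0) => u v; rewrite mxE.
rewrite rmorphD rmorphM /= horner_mx_X horner_mx_C mulmxDr.
apply: dist_invariantD; first by rewrite mulmxA; apply: inv_adj.
by rewrite mul_mx_scalar; apply: dist_invariantZ.
Qed.

(* [q] is the minimal polynomial of the adjacency matrix divided by ['X - theta], so that [conj(q(A)) q(A)] is positive semidefinite, supported on the [theta]-eigenspace, and constant on each distance class. *)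
Lemma delsarte_bound C : clique e C -> (0 < #|C|)%N ->
  0 <= k%:R + (#|C|.-1)%:R * theta.
Proof.
move=> clC C0; set A := adj e.
have := theta_eig; rewrite eigenvalue_root_min => /factor_theorem[q pE].
pose B := horner_mx A q.
have BA : B *m A = theta *: B.
  have := mx_root_minpoly A; rewrite pE rmorphM rmorphB /= horner_mx_X horner_mx_C.
  rewrite mulrBr => /eqP; rewrite subr_eq0 => /eqP h.
  by rewrite -mul_mx_scalar.
(* [q] has smaller degree than the minimal polynomial, so it does not annihilate [A]. *)
have B0 : B != 0.
  apply/negP => /eqP /mxminpoly_min dv; have := size_mxminpoly A.
  have pn0 : mxminpoly A != 0 by rewrite monic_neq0 // mxminpoly_monic.
  have qn0 : q != 0 by apply: contraNneq pn0 => q0; rewrite pE q0 mul0r.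
  have := dvdp_leq qn0 dv; rewrite pE size_Mmonic ?monicXsubC // size_XsubC.
  by rewrite addn2 /= ltnn.
have [g gE] : dist_invariant e B.
  rewrite -[B]mul1mx; apply: dist_invariant_horner.
  by exists (fun i => (i == 0)%:R) => u v; rewrite mxE (dist_eq0 econ).
have Bsym u v : B u v = B v u by rewrite !gE (dist_sym esym econ).
pose E := map_mx Num.conj B *m B.
have [f fE] : dist_invariant e E.
  apply: dist_invariant_horner; exists (fun i => (g i)^*) => u v.
  by rewrite mxE gE.
have EA : E *m A = theta *: E by rewrite -mulmxA BA scalemxAr.
have f0E u : f 0%N = \sum_z `|B u z| ^+ 2.
  have <- : E u u = f 0%N by rewrite fE (distxx econ).
  rewrite mxE; apply: eq_bigr => z _.
  by rewrite mxE (Bsym z u) normCK mulrC.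
have f0 : 0 < f 0%N.
  have [u [v Buv]] : exists u v, B u v != 0.
    case/matrix0Pn: B0 => u [v h]; by exists u, v.
  rewrite (f0E u) (bigD1 v) //= ltr_wpDr ?exprn_gt0 ?normr_gt0 //.
  by apply: sumr_ge0 => z _; rewrite exprn_ge0.
(* Compare diagonal entries in [E *m A = theta *: E]. *)
have f1 : k%:R * f 1%N = theta * f 0%N.
  pose u : 'I_n.+1 := ord0.
  have := congr1 (fun M : 'M_n.+1 => M u u) EA; rewrite /= [RHS]mxE fE (distxx econ) => <-.
  have -> : k%:R = \sum_x (e u x)%:R :> algC.
    rewrite -(degree u) -sum1_card natr_sum big_mkcond /=.
    by apply: eq_bigr => x _; rewrite inE; case: (e u x).
  rewrite mxE mulr_suml; apply: eq_bigr => x _; rewrite fE mxE (esym x u).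
  case h: (e u x); last by rewrite mulr0 mul0r.
  by rewrite (dist_edge eirr econ h) mulr1 mul1r.
(* As [B] is symmetric, this sum is the squared norm of [B] applied to the indicator of [C]. *)
have pos : 0 <= \sum_(u in C) \sum_(v in C) E u v.
  have -> : \sum_(u in C) \sum_(v in C) E u v = \sum_z `|\sum_(v in C) B z v| ^+ 2.
    under eq_bigr => u _ do under eq_bigr => v _ do rewrite mxE.
    under eq_bigr => u _ do rewrite exchange_big /=.
    rewrite exchange_big /=; apply: eq_bigr => z _.
    rewrite normCK rmorph_sum mulrC mulr_suml /=; apply: eq_bigr => u _.
    by rewrite mulr_sumr; apply: eq_bigr => v _; rewrite mxE (Bsym u z).
  by apply: sumr_ge0 => z _; rewrite exprn_ge0.
have sumE : \sum_(u in C) \sum_(v in C) E u v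
    = #|C|%:R * (f 0%N + (#|C|.-1)%:R * f 1%N).
  rewrite mulr_natl -sumr_const; apply: eq_bigr => u uC.
  rewrite (bigD1 u) //= fE (distxx econ); congr (_ + _).
  have -> : #|C|.-1 = #|C :\ u| by rewrite (cardsD1 u C) uC.
  rewrite mulr_natl -sumr_const; apply: eq_big => [v|v /andP[vC vu]].
    by rewrite in_setD1 andbC.
  by rewrite fE (dist_edge eirr econ) //; apply: clC; rewrite // eq_sym.
have C0R : 0 < #|C|%:R :> algC by rewrite ltr0n.
move: pos; rewrite sumE pmulr_rge0 // => pos.
have kR : 0 < k%:R :> algC by rewrite ltr0n.
have : 0 <= k%:R * (f 0%N + (#|C|.-1)%:R * f 1%N) by rewrite mulr_ge0 // ltW.
rewrite mulrDr mulrCA f1 mulrA -mulrDl pmulr_lge0 //.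
Qed.

End DelsarteBound.

(** * The incidence matrix of a partial linear space *)

Section LineGeometry.
Variables (n : nat) (e : rel 'I_n) (S : {set {set 'I_n}}) (m : nat).
Hypothesis eirr : irreflexive e.
Hypothesis S_clique : forall C, C \in S -> clique e C.
Hypothesis S_edge : forall u v, e u v -> #|[set C in S | (u \in C) && (v \in C)]| = 1%N.
Hypothesis S_vertex : forall v, #|[set C in S | v \in C]| = m.

Definition incidence : 'M[algC]_(n, #|S|) :=
  \matrix_(v, j) (v \in (enum_val j : {set 'I_n}))%:R.

Lemma incidence_mul_tr : incidence *m incidence^T = adj e + m%:R%:M.
Proof.
apply/matrixP => u v; rewrite !mxE.
have -> : \sum_j incidence u j * incidence^T j v
    = #|[set C in S | (u \in C) && (v \in C)]|%:R.
  under eq_bigr => j _ do rewrite !mxE -natrM mulnb.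
  rewrite -(big_enum_val (fun C : {set 'I_n} => ((u \in C) && (v \in C))%:R)) /=.
  rewrite -sum1_card natr_sum big_mkcond [RHS]big_mkcond /=; apply: eq_bigr => C _.
  by rewrite in_set; case: (C \in S) => //=; case: (_ && _).
case: (eqVneq u v) => [<-|uv].
  rewrite eirr add0r mulr1n -(S_vertex u); congr (_%:R); apply: eq_card => C.
  by rewrite !in_set andbb.
rewrite mulr0n addr0; case: (boolP (e u v)) => [/S_edge ->//|nuv].
rewrite (_ : [set _ in _ | _] = set0) ?cards0 //; apply/setP => C.
rewrite in_set in_set0; apply/negP => /and3P[CS uC vC].
by rewrite (S_clique CS) in nuv.
Qed.

(** For an eigenvector [x], the squared norm of [x *m incidence] is [t + m] times that of [x]. *)
Lemma eigenvalue_ge t : eigenvalue (adj e) t -> - m%:R <= t.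
Proof.
case/eigenvalueP => x xA x0; rewrite -subr_ge0 opprK.
pose y := x *m incidence.
have yN : y *m incidence^T = (t + m%:R) *: x.
  by rewrite -mulmxA incidence_mul_tr mulmxDr xA mul_mx_scalar scalerDl.
have key : \sum_j `|y 0 j| ^+ 2 = (t + m%:R) * \sum_u `|x 0 u| ^+ 2.
  rewrite mulr_sumr.
  have -> : \sum_u (t + m%:R) * `|x 0 u| ^+ 2 = \sum_u (y *m incidence^T) 0 u * (x 0 u)^*.
    by apply: eq_bigr => u _; rewrite yN mxE normCK mulrA.
  under [RHS]eq_bigr => u _ do rewrite mxE mulr_suml.
  rewrite exchange_big /=; apply: eq_bigr => j _.
  rewrite normCK {2}/y mxE rmorph_sum mulr_sumr; apply: eq_bigr => u _.
  by rewrite rmorphM /= !mxE conjC_nat -mulrA [_^* * _]mulrC.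
have xpos : 0 < \sum_u `|x 0 u| ^+ 2.
  case/matrix0Pn: x0 => i [u]; rewrite ord1 => xu.
  rewrite (bigD1 u) //= ltr_wpDr ?exprn_gt0 ?normr_gt0 //.
  by apply: sumr_ge0 => z _; rewrite exprn_ge0.
rewrite -(pmulr_lge0 _ xpos) -key.
by apply: sumr_ge0 => z _; rewrite exprn_ge0.
Qed.

Lemma eigenvalue_opp_m : (#|S| < n)%N -> eigenvalue (adj e) (- m%:R).
Proof.
move=> Sn; apply/eigenvalueP.
have : kermx incidence != 0.
  rewrite -mxrank_eq0 mxrank_ker subn_eq0 -ltnNge.
  exact: leq_ltn_trans (rank_leq_col _) Sn.
case/rowV0Pn => x /sub_kermxP xN x0; exists x => //.
have := congr1 (mulmx x) incidence_mul_tr.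
rewrite mulmxA xN mul0mx mulmxDr mul_mx_scalar => /eqP.
by rewrite eq_sym addr_eq0 scaleNr => /eqP.
Qed.

End LineGeometry.

(** * Assembly of the dichotomy *)

Local Open Scope nat_scope.

Lemma motion_lower n (e : rel 'I_n) G : 0 < G ->
    (forall s x, is_aut e s -> s x != x -> n <= G * #|[set v | s v != v]|) ->
  n <= G * motion e.
Proof.
move=> G0 h; rewrite /motion; apply: (big_ind (fun m => n <= G * m)).
- by rewrite leq_pmull.
- by move=> p q hp hq; rewrite /minn; case: ifP.
move=> s /andP[/forallP hs s1].
have aut_s : is_aut e s by move=> u v; apply/eqP; have /forallP := hs u; apply.
have [x sx] : exists x, s x != x.
  apply/existsP; apply: contraR s1 => /existsPn fix_s; apply/eqP/permP => x.
  by rewrite perm1; have := fix_s x; rewrite negbK => /eqP.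
exact: h aut_s sx.
Qed.

(** With [- m] the least eigenvalue, Delsarte's bound gives [#|C|.-1 <= k / m] for each line. The
    [m] lines through a vertex have these numbers summing to [k], so equality holds. *)
Lemma geometric_of_lines n (e : rel 'I_n.+1) (S : {set {set 'I_n.+1}}) k m :
    simple_graph e -> connected e -> regular e k ->
    (forall M : 'M[algC]_n.+1, dist_invariant e M -> dist_invariant e (M *m adj e)%R) ->
    0 < k -> 0 < m -> #|S| < n.+1 ->
    (forall C, C \in S -> clique e C /\ 0 < #|C|) ->
    (forall u v, e u v -> #|[set C in S | (u \in C) && (v \in C)]| = 1) ->
    (forall v, #|[set C in S | v \in C]| = m) ->
    (forall v, \sum_(C in [set C in S | v \in C]) #|C|.-1 = k) ->
  geometric e /\ forall theta, is_min_eig e theta -> (- m%:R <= theta)%R.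
Proof.
move=> [esym eirr] econ reg inv_adj k0 m0 Sn hC hE hV hk.
have S_clique C : C \in S -> clique e C by case/hC.
have eig := eigenvalue_opp_m eirr S_clique hE hV Sn.
have ge := eigenvalue_ge eirr S_clique hE hV.
split; last by move=> theta [/ge].
have mR : (0 < m%:R :> algC)%R by rewrite ltr0n.
have size_le C : C \in S -> #|C|.-1 * m <= k.
  move=> /hC[clC C0].
  have := delsarte_bound esym eirr econ reg inv_adj k0 eig clC C0.
  by rewrite mulrN subr_ge0 -natrM ler_nat.
have size_eq C : C \in S -> #|C|.-1 * m = k.
  move=> CS; have [_ /card_gt0P[v vC]] := hC _ CS.
  pose T := [set C in S | v \in C].
  have CT : C \in T by rewrite inE CS.
  apply/eqP; rewrite eqn_leq size_le //= -(leq_add2r (\sum_(C' in T :\ C) k)).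
  have <- : \sum_(C' in T) k = k + \sum_(C' in T :\ C) k by rewrite (big_setD1 C).
  have -> : \sum_(C' in T) k = \sum_(C' in T) #|C'|.-1 * m.
    by rewrite -big_distrl /= hk sum_nat_const hV mulnC.
  rewrite (big_setD1 C) //= leq_add2l.
  by apply: leq_sum => C' /setD1P[_ /setIdP[C'S _]]; apply: size_le.
exists k, (- m%:R)%R; split=> //.
exists S; split=> // C CS; have [clC C0] := hC C CS; split=> //.
rewrite invrN mulrN opprK -(size_eq C CS) natrM mulfK ?lt0r_neq0 //.
by rewrite -[X in (X + _)%R]/(1%:R)%R -natrD add1n prednK.
Qed.

Section Dichotomy.
Variables (n d : nat) (e : rel 'I_n.+1) (a b c : nat -> nat).
Hypotheses (esym : symmetric e) (eirr : irreflexive e) (econ : connected e).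
Hypothesis dist_le_diam : forall u v, dist e u v <= d.
Hypothesis diam_attained : exists u v, dist e u v = d.
Hypothesis cE : forall v w,
  #|[set x | e w x & dist e v x == (dist e v w).-1]| = c (dist e v w).
Hypothesis aE : forall v w,
  #|[set x | e w x & dist e v x == dist e v w]| = a (dist e v w).
Hypothesis bE : forall v w,
  #|[set x | e w x & dist e v x == (dist e v w).+1]| = b (dist e v w).
Hypothesis d_ge3 : 3 <= d.

Local Notation N := (d ^ 4).
Local Notation Q := (256 * N ^ 3).

Let N_gt0 : 0 < N. Proof. by rewrite expn_gt0; case: d d_ge3. Qed.

Let Q_ge : 256 * N ^ 2 <= Q.
Proof. by rewrite leq_mul2l leq_pexp2l. Qed.

Let Q_ge' : 100 * d <= Q.
Proof.
by rewrite -expnM leq_mul // -{1}(expn1 d) leq_pexp2l //; case: d d_ge3.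
Qed.

Lemma geometric_of_large_triangles t : t <= d ->
    Q * (n.+1 - valency b c t) <= valency b c t -> 3 * b 0 <= 2 * N * a 1 ->
  geometric e /\ forall theta, is_min_eig e theta -> (- N%:R <= theta)%R.
Proof.
move=> td dom large.
have k0 : 0 < b 0 by apply: (b_gt0 esym eirr econ diam_attained bE); case: d d_ge3.
have mu0 : 0 < c 2.
  by apply: (c_gt0 esym eirr econ diam_attained cE); rewrite (ltnW d_ge3).
have t2 := dominant_ge2 esym eirr econ dist_le_diam diam_attained cE bE d_ge3 td Q_ge' dom.
have muQ : Q * c 2 <= b 0.
  by apply: (dominant_c_le esym eirr econ dist_le_diam diam_attained cE bE
    d_ge3 td Q_ge' dom); rewrite ?t2 // (ltnW t2).
(* The third factor [N] in [Q] is spent here: [Q * c 2 <= b 0], and [b 0] is at most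
   [2 / 3 * N * a 1]. *)
have mu_small : 100 * N ^ 2 * c 2 <= a 1.
  rewrite -(leq_pmul2l N_gt0); move: muQ large; rewrite [N ^ 3]expnS.
  by move: N (N ^ 2) (b 0) (c 2) (a 1) => x y z w v; nia.
have deg := degreeE esym eirr econ bE.
have adj_la u v : e u v -> #|[set z | e u z & e v z]| = a 1.
  by move=> uv; apply: (common_neighbors1 esym eirr econ aE); apply: dist_edge.
have nonadj_mu u v : u != v -> ~~ e u v -> #|[set z | e u z & e v z]| <= c 2.
  rewrite -(dist_eq0 econ) -(dist1E esym eirr econ).
  case h: (dist e u v) => [|[|[|i]]] // _ _.
    by rewrite (common_neighbors2 esym eirr econ cE h).
  by rewrite (common_neighbors3 esym eirr econ) ?cards0 // h.
pose S := lines e (a 1); pose m := #|lines_through e (a 1) ord0|.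
have la0 : 0 < a 1.
  by apply: leq_trans mu_small; rewrite muln_gt0 mu0 andbT muln_gt0 expn_gt0 N_gt0.
have [] := @geometric_of_lines n e S (b 0) m.
- by [].
- by [].
- exact: deg.
- move=> M; exact: (dist_invariant_mul_adj esym eirr econ cE aE bE).
- exact: k0.
- exact: (card_lines_through_gt0 esym eirr deg adj_la nonadj_mu k0 mu0 N_gt0 large mu_small).
- exact: (card_lines_lt esym eirr deg adj_la nonadj_mu mu0 N_gt0 large mu_small).
- move=> C CS; split; first exact: line_clique CS.
  by have := line_size CS; case: #|C| => //; move: la0; clear; lia.
- move=> u v; exact: (edge_in_one_line esym eirr deg adj_la nonadj_mu mu0 N_gt0 large mu_small).
- move=> v; exact: (card_lines_through_const esym eirr deg adj_la nonadj_mu mu0 N_gt0 large mu_small).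
- move=> v; exact: (sum_line_degree esym eirr deg adj_la nonadj_mu mu0 N_gt0 large mu_small).
move=> geo ge; split=> // theta /ge; apply: le_trans; rewrite lerN2 ler_nat.
exact: (card_lines_through_le_N esym eirr deg adj_la nonadj_mu mu0 N_gt0 large mu_small).
Qed.

(** The sum of the constants of the two cases that bound the motion: no dominant distance, and a
    dominant one with few triangles. *)
Definition motion_const : nat := Q.+1 * d + 48 * N * (16 * N) ^ d.

Lemma motion_or_geometric : primitive e d ->
  n.+1 <= motion_const * motion e \/
  (geometric e /\ forall theta, is_min_eig e theta -> (- N%:R <= theta)%R).
Proof.
move=> prim; have G0 : 0 < motion_const.
  by rewrite addn_gt0 muln_gt0 /=; case: d d_ge3.
case: (boolP [exists t : 'I_d.+1,
    Q * (n.+1 - valency b c t) <= valency b c t]) => [/existsP[t dom]|].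
  have td : t <= d := leq_ord t.
  case: (ltnP (2 * N * a 1) (3 * b 0)) => h; last first.
    by right; apply: geometric_of_large_triangles td dom h.
  left; apply: motion_lower => // s x aut_s sx.
  (* The conclusion is about natural numbers, so any ordered field serves for the estimates; [rat]
     is chosen. *)
  have := gap_motion esym eirr econ dist_le_diam diam_attained cE aE bE rat
    d_ge3 td Q_ge dom h aut_s sx.
  by move=> /leq_trans; apply; rewrite leq_mul2r leq_addl orbT.
move=> /existsPn nodom; left; apply: motion_lower => // s x aut_s sx.
have moved := card_moved_ge_distinguishing econ x aut_s.
have dpos : 0 < dist e x (s x) <= d.
  by rewrite dist_le_diam lt0n (dist_eq0 econ) eq_sym sx.
(* Primitivity at the distance from [x] to [s x] bounds every pair by [d] times this one, which is
   at most the number of moved vertices. *)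
have all_le u v := distinguishing_primitive esym eirr econ dist_le_diam
  diam_attained cE aE bE rat u v (prim _ dpos) erefl.
have nd i : i <= d -> valency b c i < Q * (n.+1 - valency b c i).
  by move=> id; have := nodom (Ordinal (id : i < d.+1)); rewrite -ltnNge.
have := exists_well_distinguished esym eirr econ dist_le_diam diam_attained cE bE
  nd all_le.
move=> /leq_trans; apply; rewrite mulnA; apply: leq_mul => //.
exact: leq_addr.
Qed.

End Dichotomy.

Local Open Scope ring_scope.

Theorem theorem4 (d : nat) (hd : (3 <= d)%N) :
  exists gamma : algC, 0 < gamma /\
    forall (n : nat) (e : rel 'I_n),
      distance_regular e d -> primitive e d ->
      gamma * n%:R <= (motion e)%:R \/
      (geometric e /\
       forall theta : algC, is_min_eig e theta -> - (m_d d)%:R <= theta).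
Proof.
have G0 : 0 < (motion_const d)%:R :> algC.
  by rewrite ltr0n addn_gt0 muln_gt0 /=; case: d hd.
exists (motion_const d)%:R^-1; rewrite invr_gt0; split=> // n e.
move=> [[esym eirr] econ [dle dex] [a [b [c abc]]]] prim.
(* For [n = 0] no pair attains the diameter; otherwise the vertex set is inhabited, as matrix
   polynomials and [ord0] require. *)
case: n e esym eirr econ dle dex abc prim => [|n] e esym eirr econ dle dex abc prim.
  by have [[]] := dex.
have := @motion_or_geometric n d e a b c esym eirr econ dle dex _ _ _ hd prim.
case=> [v w|v w|v w||[geo ge]]; try by have [] := abc _ (dle v w) v w erefl.
  by move=> le; left; rewrite mulrC ler_pdivrMr // mulrC -natrM ler_nat.
right; split=> // theta /ge; apply: le_trans.
by rewrite lerN2 ler_nat expn4_le_m_d // (leq_trans _ hd).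
Qed.
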